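(* Let $A$ and $\Gamma$ be noetherian rings and let ${}_\Gamma M_A$ and ${}_AN_\Gamma$ be bimodules, each finitely generated both as a left and as a right module. Suppose that the bimodules ${}_\Gamma M_A$, ${}_AN_\Gamma$ and ${}_\Gamma(M\otimes_AN)_\Gamma$ are weakly compatible. Let $J:=M\otimes_AN$, let $B:=\Gamma\ltimes J$ be the trivial extension, and let $C:=C(A,\Gamma,M,N,0,0)$ be the noncommutative tensor product arising from the Morita context $(A,\Gamma,M,N,0,0)$. Then a finitely generated left $C$-module $({}_AX,{}_BY,f,g)$ is Gorenstein-projective if (i) ${}_\Gamma\mathrm{Coker}(f)$ and ${}_A\mathrm{Coker}(g)$ are Gorenstein-projective, and (ii) there are isomorphisms $N\otimes_B\mathrm{Coker}(f)\simeq\mathrm{Im}(g)$ of left $A$-modules, $M\otimes_A\mathrm{Coker}(g)\simeq\mathrm{Im}(f)/JY$ of left $B$-modules, and $J\otimes_B\mathrm{Coker}(f)\simeq JY$ of left $B$-modules.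
   Context: Rings are unital and associative; noetherian means left and right noetherian; modules are finitely generated. For a ring $R$, $R\text{-proj}$ is the category of finitely generated projective left $R$-modules. The trivial extension $B=\Gamma\ltimes J$ is $\Gamma\oplus J$ with $(b,j)(b',j')=(bb',bj'+jb')$. The ring $C(A,\Gamma,M,N,0,0)$ has underlying abelian group $\left(\begin{smallmatrix}A&N\\ M&\Gamma\oplus(M\otimes_AN)\end{smallmatrix}\right)$ with multiplication $$\begin{pmatrix}a_1&n_1\\ m_1&(b_1,m\otimes n)\end{pmatrix}\circ\begin{pmatrix}a_2&n_2\\ m_2&(b_2,m'\otimes n')\end{pmatrix}=\begin{pmatrix}a_1a_2&a_1n_2+n_1b_2\\ m_1a_2+b_1m_2&\big(b_1b_2,\ m_1\otimes n_2+(b_1m')\otimes n'+m\otimes(nb_2)\big)\end{pmatrix}.$$ Regard $M$ as a $B$-$A$-bimodule and $N$ as an $A$-$B$-bimodule via the canonical surjection $B\to\Gamma$, and let $\phi:M\otimes_AN\to B$, $m\otimes n\mapsto(0,m\otimes n)$. Then $C$ is the Morita context ring $\Lambda_{(\phi,0)}=\left(\begin{smallmatrix}A&N\\ M&B\end{smallmatrix}\right)$ of the Morita context $(A,B,M,N,\phi,0)$, with multiplication $\left(\begin{smallmatrix}a&n\\ m&b\end{smallmatrix}\right)\left(\begin{smallmatrix}a'&n'\\ m'&b'\end{smallmatrix}\right)=\left(\begin{smallmatrix}aa'&an'+nb'\\ ma'+bm'&\phi(m\otimes n')+bb'\end{smallmatrix}\right)$. Accordingly a left $C$-module is a quadruple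 $(X,Y,f,g)$ with $X$ a left $A$-module, $Y$ a left $B$-module, $f:M\otimes_AX\to Y$ a $B$-homomorphism and $g:N\otimes_BY\to X$ an $A$-homomorphism such that $g(n\otimes f(m\otimes x))=0$ and $f(m\otimes g(n\otimes y))=\phi(m\otimes n)y$. Here $J$ is viewed as an ideal of $B$; one has $JY\subseteq\mathrm{Im}(f)$ and $J\,\mathrm{Coker}(f)=0$, so $\mathrm{Coker}(f)$ is a $\Gamma$-module. A complex $P^\bullet$ of left $R$-modules is totally exact if it is exact and $\mathrm{Hom}_R(P^\bullet,R)$ is exact. A left $R$-module $X$ is Gorenstein-projective if $X=\mathrm{Ker}(d_P^0)$ for some totally exact complex $P^\bullet$ of projective left $R$-modules. A bimodule ${}_RU_S$ is weakly compatible if $\mathrm{Hom}_R(P^\bullet,U)$ is exact for every totally exact complex $P^\bullet$ with terms in $R\text{-proj}$, and $U\otimes_SQ^\bullet$ is exact for every totally exact complex $Q^\bullet$ with terms in $S\text{-proj}$. *)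

(* Defs.v *)
From HB Require Import structures.
From mathcomp Require Import all_boot all_order all_algebra.
From mathcomp Require Import boolp.
Set Implicit Arguments.
Unset Strict Implicit.
Unset Printing Implicit Defensive.
Import GRing.Theory.
Local Open Scope ring_scope.
Local Open Scope quotient_scope.

(* Rings are [pzRingType]s (unital, associative, the zero ring allowed) and   *)
(* left modules are [lmodType]s.                                              *)

HB.mixin Record isRightModule (S : pzRingType) U of GRing.Zmodule U := {
  rscale : U -> S -> U;
  rscaleA : forall u s t, rscale (rscale u s) t = rscale u (s * t);
  rscale1 : forall u, rscale u 1 = u;
  rscaleDl : forall u v s, rscale (u + v) s = rscale u s + rscale v s;
  rscaleDr : forall u s t, rscale u (s + t) = rscale u s + rscale u t
}.

#[short(type="rmodType")]
HB.structure Definition RightModule (S : pzRingType) :=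
  {U of GRing.Zmodule U & isRightModule S U}.

HB.mixin Record isBimodule (R S : pzRingType) U
    of GRing.Lmodule R U & RightModule S U := {
  scale_rscale : forall (r : R) (u : U) (s : S),
    r *: (rscale u s) = rscale (r *: u) s
}.

#[short(type="bimodType")]
HB.structure Definition Bimodule (R S : pzRingType) :=
  {U of GRing.Lmodule R U & RightModule S U & isBimodule R S U}.

Section RightModuleTheory.
Variables (S : pzRingType) (U : rmodType S).
Lemma rscale0l (s : S) : rscale (0 : U) s = 0.
Proof. by apply: (addrI (rscale (0 : U) s)); rewrite -rscaleDl !addr0. Qed.
Lemma rscale0r (u : U) : rscale u 0 = 0.
Proof. by apply: (addrI (rscale u 0)); rewrite -rscaleDr !addr0. Qed.
End RightModuleTheory.

(* a right S-module as a left module over the opposite ring S^c *)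
Definition rmod_op (S : pzRingType) (U : Type) : Type := U.

Section RmodOp.
Variables (S : pzRingType) (U : rmodType S).
Local Notation V := (rmod_op S U).
HB.instance Definition _ := GRing.Zmodule.on V.
Definition op_scale (s : S^c) (u : V) : V := rscale (u : U) s.
Fact op_scaleA (a b : S^c) (v : V) : op_scale a (op_scale b v) = op_scale (a * b) v.
Proof. exact: rscaleA. Qed.
Fact op_scale1 : left_id 1 op_scale.
Proof. by move=> v; apply: rscale1. Qed.
Fact op_scaleDr : right_distributive op_scale +%R.
Proof. by move=> s u v; apply: rscaleDl. Qed.
Fact op_scaleDl (v : V) : {morph op_scale^~ v : a b / a + b}.
Proof. by move=> s t; apply: rscaleDr. Qed.
HB.instance Definition _ := GRing.Zmodule_isLmodule.Build S^c V
  op_scaleA op_scale1 op_scaleDr op_scaleDl.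
End RmodOp.

Definition resl (R S : pzRingType) (phi : {rmorphism R -> S}) (U : Type) : Type := U.
Definition resr (R S : pzRingType) (phi : {rmorphism R -> S}) (U : Type) : Type := U.

Section ResL.
Variables (R S T : pzRingType) (phi : {rmorphism R -> S}).

Section Lmod.
Variable U : lmodType S.
HB.instance Definition _ := GRing.Zmodule.on (resl phi U).
Definition resl_scale (r : R) (u : resl phi U) : resl phi U := phi r *: (u : U).
Fact resl_scaleA a b v : resl_scale a (resl_scale b v) = resl_scale (a * b) v.
Proof. by rewrite /resl_scale rmorphM scalerA. Qed.
Fact resl_scale1 : left_id 1 resl_scale.
Proof. by move=> v; rewrite /resl_scale rmorph1 scale1r. Qed.
Fact resl_scaleDr : right_distributive resl_scale +%R.
Proof. by move=> a u v; apply: scalerDr. Qed.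
Fact resl_scaleDl v : {morph resl_scale^~ v : a b / a + b}.
Proof. by move=> a b; rewrite /resl_scale rmorphD scalerDl. Qed.
HB.instance Definition _ := GRing.Zmodule_isLmodule.Build R (resl phi U)
  resl_scaleA resl_scale1 resl_scaleDr resl_scaleDl.
End Lmod.

Section Bimod.
Variable U : bimodType S T.
HB.instance Definition _ := isRightModule.Build T (resl phi U)
  (@rscaleA T U) (@rscale1 T U) (@rscaleDl T U) (@rscaleDr T U).
Fact resl_bimod (r : R) (u : resl phi U) (t : T) :
  r *: (rscale u t : resl phi U) = rscale (r *: u : resl phi U) t.
Proof. exact: scale_rscale. Qed.
HB.instance Definition _ := isBimodule.Build R T (resl phi U) resl_bimod.
End Bimod.
End ResL.

Section ResR.
Variables (R S T : pzRingType) (phi : {rmorphism R -> S}).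

Section Rmod.
Variable U : rmodType S.
HB.instance Definition _ := GRing.Zmodule.on (resr phi U).
Definition resr_scale (u : resr phi U) (r : R) : resr phi U := rscale (u : U) (phi r).
Fact resr_scaleA u s t : resr_scale (resr_scale u s) t = resr_scale u (s * t).
Proof. by rewrite /resr_scale rmorphM -rscaleA. Qed.
Fact resr_scale1 u : resr_scale u 1 = u.
Proof. by rewrite /resr_scale rmorph1 rscale1. Qed.
Fact resr_scaleDl u v s : resr_scale (u + v) s = resr_scale u s + resr_scale v s.
Proof. exact: rscaleDl. Qed.
Fact resr_scaleDr u s t : resr_scale u (s + t) = resr_scale u s + resr_scale u t.
Proof. by rewrite /resr_scale rmorphD rscaleDr. Qed.
HB.instance Definition _ := isRightModule.Build R (resr phi U)
  resr_scaleA resr_scale1 resr_scaleDl resr_scaleDr.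
End Rmod.

Section Bimod.
Variable U : bimodType T S.
HB.instance Definition _ := GRing.Lmodule.copy (resr phi U) U.
Fact resr_bimod (t : T) (u : resr phi U) (r : R) :
  t *: (rscale u r : resr phi U) = rscale (t *: u : resr phi U) r.
Proof. exact: scale_rscale. Qed.
HB.instance Definition _ := isBimodule.Build T R (resr phi U) resr_bimod.
End Bimod.
End ResR.

Section SubQuot.
Variables (R : pzRingType) (V : lmodType R).

Definition submod (S : submodClosed V) : Type := {x : V | x \in S}.
HB.instance Definition _ S := SubChoice.on (submod S).
HB.instance Definition _ S :=
  [SubChoice_isSubLmodule of submod S by <:].

Section Quot.
Variable S : submodClosed V.
(* [submodClosed] does not record stability under opposite *)
Definition zpred : {pred V} := [pred x | x \in S].
Fact zpred_closed : zmod_closed zpred.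
Proof.
split=> [|x y]; rewrite !inE ?rpred0 // => xS yS.
by rewrite rpredD // -scaleN1r rpredZ.
Qed.
HB.instance Definition _ := GRing.isZmodClosed.Build V zpred zpred_closed.
Definition quotmod : Type := Quotient.quot zpred.
HB.instance Definition _ := GRing.Zmodule.on quotmod.
Definition quotmod_pi (x : V) : quotmod := \pi_(Quotient.quot zpred) x.
Definition quotmod_repr (x : quotmod) : V := repr (x : Quotient.quot zpred).
Lemma quotmod_reprK : cancel quotmod_repr quotmod_pi.
Proof. exact: reprK. Qed.
Lemma quotmod_eq x y : (quotmod_pi x == quotmod_pi y) = (x - y \in S).
Proof. by rewrite -[RHS]/(x - y \in zpred) Quotient.idealrBE. Qed.
Lemma quotmod_piD : {morph quotmod_pi : x y / x + y}.
Proof. by move=> x y; rewrite /quotmod_pi -(raddfD (\pi_(Quotient.quot zpred))). Qed.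
Lemma quotmod_pi_eq0 x : (quotmod_pi x == 0) = (x \in S).
Proof.
rewrite -[x in RHS]subr0 -quotmod_eq; congr (_ == _).
by apply: (addrI (quotmod_pi 0)); rewrite -quotmod_piD !addr0.
Qed.
Definition quotmod_scale (r : R) (x : quotmod) : quotmod :=
  quotmod_pi (r *: quotmod_repr x).
Lemma quotmod_piZ r x : quotmod_pi (r *: x) = quotmod_scale r (quotmod_pi x).
Proof.
apply/eqP; rewrite quotmod_eq -scalerBr rpredZ //.
by rewrite -quotmod_eq quotmod_reprK.
Qed.
Fact quotmod_scaleA a b v :
  quotmod_scale a (quotmod_scale b v) = quotmod_scale (a * b) v.
Proof. by rewrite -[v]quotmod_reprK -!quotmod_piZ scalerA. Qed.
Fact quotmod_scale1 : left_id 1 quotmod_scale.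
Proof. by move=> v; rewrite -[v]quotmod_reprK -quotmod_piZ scale1r. Qed.
Fact quotmod_scaleDr : right_distributive quotmod_scale +%R.
Proof.
move=> a u v; rewrite -[u]quotmod_reprK -[v]quotmod_reprK.
by rewrite -quotmod_piD -!quotmod_piZ scalerDr quotmod_piD.
Qed.
Fact quotmod_scaleDl v : {morph quotmod_scale^~ v : a b / a + b}.
Proof.
by move=> a b; rewrite -[v]quotmod_reprK -!quotmod_piZ scalerDl quotmod_piD.
Qed.
HB.instance Definition _ := GRing.Zmodule_isLmodule.Build R quotmod
  quotmod_scaleA quotmod_scale1 quotmod_scaleDr quotmod_scaleDl.
End Quot.

(* the intersection of S and T, as a submodule of S *)
Section Inside.
Variables S T : submodClosed V.
Definition sub_inside : {pred submod S} := [pred z | val z \in T].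
Fact sub_inside_closed : subsemimod_closed sub_inside.
Proof.
by split; [split=> [|x y]; rewrite !inE ?rpred0 // => *; rewrite rpredD
  | move=> a x; rewrite !inE => *; rewrite rpredZ].
Qed.
HB.instance Definition _ :=
  GRing.isSubmodClosed.Build R (submod S) sub_inside sub_inside_closed.
End Inside.
End SubQuot.
#[global] Arguments sub_inside {R V} S T _.

Section ImKer.
Variables (R : pzRingType) (U V : lmodType R) (f : {linear U -> V}).
Definition im : {pred V} := [pred y | `[< exists x, f x = y >]].
Definition ker : {pred U} := [pred x | f x == 0].
Fact im_closed : subsemimod_closed im.
Proof.
split; [split|]; first by apply/asboolP; exists 0; rewrite linear0.
  move=> x y /asboolP[u <-] /asboolP[v <-].
  by apply/asboolP; exists (u + v); rewrite linearD.
by move=> a x /asboolP[u <-]; apply/asboolP; exists (a *: u); rewrite linearZ.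
Qed.
HB.instance Definition _ := GRing.isSubmodClosed.Build R V im im_closed.
Fact ker_closed : subsemimod_closed ker.
Proof.
split; [split=> [|x y]|move=> a x]; rewrite !inE ?linear0 //.
  by move=> /eqP fx /eqP fy; rewrite linearD fx fy addr0.
by move=> /eqP fx; rewrite linearZ /= fx scaler0.
Qed.
HB.instance Definition _ := GRing.isSubmodClosed.Build R U ker ker_closed.
Definition coker := quotmod im.
HB.instance Definition _ := GRing.Lmodule.on coker.
End ImKer.

Definition lmod_iso (R : pzRingType) (U V : lmodType R) : Prop :=
  exists f : {linear U -> V}, bijective f.

Definition fin_gen (R : pzRingType) (V : lmodType R) : Prop :=
  exists (n : nat) (e : 'I_n -> V),
    forall v, exists c : 'I_n -> R, v = \sum_i c i *: e i.

Definition left_noetherian (R : pzRingType) : Prop :=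
  forall I : submodClosed R^o, fin_gen (submod I).

Definition noetherian (R : pzRingType) : Prop :=
  left_noetherian R /\ left_noetherian R^c.

Definition projective (R : pzRingType) (P : lmodType R) : Prop :=
  forall (V W : lmodType R) (p : {linear V -> W}) (h : {linear P -> W}),
    (forall w, exists v, p v = w) ->
    exists k : {linear P -> V}, forall x, p (k x) = h x.

(* Presentation by generators and relations: formal finite sums of pairs,     *)
(* modulo the additive congruence generated by bilinearity and balancedness.  *)
(* Formal negatives are not needed, as (- u, v) is an inverse of (u, v).      *)
Section Tensor.
Variables (S : pzRingType) (U : rmodType S) (V : lmodType S).

Inductive tensor_rel : seq (U * V) -> seq (U * V) -> Prop :=
| tr_refl s : tensor_rel s s
| tr_sym s t : tensor_rel s t -> tensor_rel t s
| tr_trans s t r : tensor_rel s t -> tensor_rel t r -> tensor_rel s r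
| tr_cat s s' t t' :
    tensor_rel s s' -> tensor_rel t t' -> tensor_rel (s ++ t) (s' ++ t')
| tr_comm s t : tensor_rel (s ++ t) (t ++ s)
| tr_zero v : tensor_rel [:: (0, v)] [::]
| tr_addl u u' v : tensor_rel [:: (u + u', v)] [:: (u, v); (u', v)]
| tr_addr u v v' : tensor_rel [:: (u, v + v')] [:: (u, v); (u, v')]
| tr_bal u a v : tensor_rel [:: (rscale u a, v)] [:: (u, a *: v)].

Definition tensor_relb : rel (seq (U * V)) := fun s t => `[< tensor_rel s t >].

Fact tensor_relb_equiv : equiv_class_of tensor_relb.
Proof.
split=> [s|s t|t s r].
- exact/asboolP/tr_refl.
- by apply/asboolP/asboolP => /tr_sym.
- by move=> /asboolP st /asboolP tr; apply/asboolP/(tr_trans st tr).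
Qed.
Canonical tensor_equiv := EquivRelPack tensor_relb_equiv.

Definition tensor : Type := {eq_quot tensor_equiv}.
HB.instance Definition _ := Choice.on tensor.

Definition tsum (s : seq (U * V)) : tensor := \pi_({eq_quot tensor_equiv}) s.
Definition trepr (t : tensor) : seq (U * V) := repr (t : {eq_quot tensor_equiv}).
Definition tens (u : U) (v : V) : tensor := tsum [:: (u, v)].

Lemma treprK : cancel trepr tsum.
Proof. exact: reprK. Qed.

Lemma tsumP s t : tsum s = tsum t <-> tensor_rel s t.
Proof.
split=> [/eqP|st]; first by rewrite piE => /asboolP.
by apply/eqP; rewrite piE; apply/asboolP.
Qed.

Definition tens_zero : tensor := tsum [::].
Definition tens_add (x y : tensor) : tensor := tsum (trepr x ++ trepr y).
Definition tens_opp (x : tensor) : tensor :=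
  tsum [seq (- p.1, p.2) | p <- trepr x].

Fact tens_addE s t : tens_add (tsum s) (tsum t) = tsum (s ++ t).
Proof. by apply/tsumP/tr_cat; apply/tsumP; rewrite treprK. Qed.

Fact tens_addA : associative tens_add.
Proof.
move=> x y z; rewrite -[x]treprK -[y]treprK -[z]treprK.
by rewrite !tens_addE catA.
Qed.
Fact tens_addC : commutative tens_add.
Proof.
by move=> x y; rewrite -[x]treprK -[y]treprK !tens_addE; apply/tsumP/tr_comm.
Qed.
Fact tens_add0 : left_id tens_zero tens_add.
Proof. by move=> x; rewrite -[x]treprK tens_addE. Qed.
Fact tens_addN : left_inverse tens_zero tens_opp tens_add.
Proof.
move=> x; rewrite -{2}[x]treprK tens_addE; apply/tsumP.
elim: (trepr x) => [|[u v] s IHs] /=; first exact: tr_refl.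
have uv : tensor_rel [:: (- u, v); (u, v)] [::].
  apply: tr_trans (tr_sym (tr_addl _ _ _)) _.
  by rewrite addNr; apply: tr_zero.
set t := map _ _ in IHs *.
have -> : (- u, v) :: t ++ (u, v) :: s
  = [:: (- u, v)] ++ ((t ++ [:: (u, v)]) ++ s) by rewrite /= -catA.
apply: tr_trans (tr_cat (tr_refl _) (tr_cat (tr_comm _ _) (tr_refl _))) _.
rewrite -[X in tensor_rel _ X]cats0; rewrite -catA.
exact: (tr_cat uv IHs).
Qed.
HB.instance Definition _ := GRing.isZmodule.Build tensor
  tens_addA tens_addC tens_add0 tens_addN.

Lemma tsum_cat s t : tsum (s ++ t) = tsum s + tsum t.
Proof. by rewrite -tens_addE. Qed.

Lemma tsumE s : tsum s = \sum_(p <- s) tens p.1 p.2.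
Proof.
elim: s => [|[u v] s IHs]; first by rewrite big_nil.
by rewrite big_cons -IHs -tsum_cat.
Qed.

Lemma tensDl u u' v : tens (u + u') v = tens u v + tens u' v.
Proof. by rewrite -tsum_cat; apply/tsumP/tr_addl. Qed.
Lemma tensDr u v v' : tens u (v + v') = tens u v + tens u v'.
Proof. by rewrite -tsum_cat; apply/tsumP/tr_addr. Qed.
Lemma tens_bal u a v : tens (rscale u a) v = tens u (a *: v).
Proof. exact/tsumP/tr_bal. Qed.

Lemma tens0l v : tens 0 v = 0.
Proof. by apply: (addrI (tens 0 v)); rewrite -tensDl !addr0. Qed.
Lemma tens0r u : tens u 0 = 0.
Proof. by apply: (addrI (tens u 0)); rewrite -tensDr !addr0. Qed.

Lemma tensor_ind (P : tensor -> Prop) :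
  P 0 -> (forall x y, P x -> P y -> P (x + y)) -> (forall u v, P (tens u v)) ->
  forall t, P t.
Proof.
move=> P0 PD Pt t; rewrite -[t]treprK tsumE.
by apply: big_ind => // p _; apply: Pt.
Qed.

Record balanced (W : zmodType) (h : U -> V -> W) : Prop := Balanced {
  balDl : forall u u' v, h (u + u') v = h u v + h u' v;
  balDr : forall u v v', h u (v + v') = h u v + h u v';
  balM : forall u a v, h (rscale u a) v = h u (a *: v)
}.

(* the additive map induced by h when h is balanced; junk otherwise *)
Definition tlift (W : zmodType) (h : U -> V -> W) (t : tensor) : W :=
  \sum_(p <- trepr t) h p.1 p.2.

Section Lift.
Variables (W : zmodType) (h : U -> V -> W).
Hypothesis hB : balanced h.

Lemma tlift_tsum s : tlift h (tsum s) = \sum_(p <- s) h p.1 p.2.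
Proof.
have /tsumP : tsum (trepr (tsum s)) = tsum s by rewrite treprK.
rewrite /tlift; move: (trepr _) => t; elim=> {s t} //=.
- by move=> s1 s2 s3 _ -> _ ->.
- by move=> s1 s2 s3 s4 _ e1 _ e2; rewrite !big_cat /= e1 e2.
- by move=> s1 s2; rewrite !big_cat /= addrC.
- move=> v; rewrite big_seq1 big_nil /=.
  by apply: (addrI (h 0 v)); rewrite -(balDl hB) !addr0.
- by move=> u u' v; rewrite !big_cons !big_nil /= !addr0 (balDl hB).
- by move=> u v v'; rewrite !big_cons !big_nil /= !addr0 (balDr hB).
- by move=> u a v; rewrite !big_seq1 /= (balM hB).
Qed.

Lemma tlift_tens u v : tlift h (tens u v) = h u v.
Proof. by rewrite tlift_tsum big_seq1. Qed.

Lemma tliftD : {morph tlift h : x y / x + y}.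
Proof.
move=> x y; rewrite -[x]treprK -[y]treprK -tsum_cat !tlift_tsum.
by rewrite big_cat.
Qed.

Lemma tlift0 : tlift h 0 = 0.
Proof. by apply: (addrI (tlift h 0)); rewrite -tliftD !addr0. Qed.

Lemma tlift_unique (k : tensor -> W) :
  {morph k : x y / x + y} -> (forall u v, k (tens u v) = h u v) ->
  k =1 tlift h.
Proof.
move=> kD kt; apply: tensor_ind => [|x y|u v].
- by rewrite tlift0; apply: (addrI (k 0)); rewrite -kD !addr0.
- by rewrite kD tliftD => -> ->.
- by rewrite kt tlift_tens.
Qed.
End Lift.
End Tensor.

Section TensorLmod.
Variables (R S : pzRingType) (U : bimodType R S) (V : lmodType S).
Local Notation T := (tensor U V).
Definition tensl (r : R) : T -> T := tlift (fun u v => tens (r *: u : U) v).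
Fact tensl_bal r : balanced (fun (u : U) (v : V) => tens (r *: u : U) v).
Proof.
by split=> *; rewrite ?scalerDr ?tensDl ?tensDr // scale_rscale tens_bal.
Qed.
Fact tensl_tens r u v : tensl r (tens u v) = tens (r *: u : U) v.
Proof. exact: tlift_tens (tensl_bal r) u v. Qed.
Fact tenslDr : right_distributive tensl +%R.
Proof. by move=> r; apply: tliftD (tensl_bal r). Qed.
Fact tensl0 r : tensl r 0 = 0.
Proof. exact: tlift0 (tensl_bal r). Qed.
Fact tenslA a b t : tensl a (tensl b t) = tensl (a * b) t.
Proof.
elim/tensor_ind: t => [|x y ex ey|u v]; first by rewrite !tensl0.
  by rewrite !tenslDr ex ey.
by rewrite !tensl_tens scalerA.
Qed.
Fact tensl1 : left_id 1 tensl.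
Proof.
elim/tensor_ind => [|x y ex ey|u v]; first by rewrite tensl0.
  by rewrite tenslDr ex ey.
by rewrite tensl_tens scale1r.
Qed.
Fact tenslDl t : {morph tensl^~ t : a b / a + b}.
Proof.
move=> a b /=; elim/tensor_ind: t => [|x y ex ey|u v].
- by rewrite !tensl0 addr0.
- by rewrite !tenslDr ex ey addrACA.
- by rewrite !tensl_tens scalerDl tensDl.
Qed.
HB.instance Definition _ := GRing.Zmodule_isLmodule.Build R T
  tenslA tensl1 tenslDr tenslDl.
Lemma scale_tens (r : R) (u : U) (v : V) : r *: tens u v = tens (r *: u : U) v.
Proof. exact: tensl_tens. Qed.
End TensorLmod.

Section TensorRmod.
Variables (S T : pzRingType) (U : rmodType S) (V : bimodType S T).
Local Notation W := (tensor U V).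
Definition tensr (x : W) (t : T) : W :=
  tlift (fun u v => tens u (rscale v t : V)) x.
Fact tensr_bal t : balanced (fun (u : U) (v : V) => tens u (rscale v t : V)).
Proof.
by split=> *; rewrite ?rscaleDl ?tensDl ?tensDr // -scale_rscale tens_bal.
Qed.
Fact tensr_tens u v t : tensr (tens u v) t = tens u (rscale v t : V).
Proof. exact: tlift_tens (tensr_bal t) u v. Qed.
Fact tensrDl x y t : tensr (x + y) t = tensr x t + tensr y t.
Proof. exact: (tliftD (tensr_bal t)). Qed.
Fact tensr0 t : tensr 0 t = 0.
Proof. exact: (tlift0 (tensr_bal t)). Qed.
Fact tensrA x a b : tensr (tensr x a) b = tensr x (a * b).
Proof.
elim/tensor_ind: x => [|x y ex ey|u v]; first by rewrite !tensr0.
  by rewrite !tensrDl ex ey.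
by rewrite !tensr_tens rscaleA.
Qed.
Fact tensr1 x : tensr x 1 = x.
Proof.
elim/tensor_ind: x => [|x y ex ey|u v]; first by rewrite tensr0.
  by rewrite tensrDl ex ey.
by rewrite tensr_tens rscale1.
Qed.
Fact tensrDr x a b : tensr x (a + b) = tensr x a + tensr x b.
Proof.
elim/tensor_ind: x => [|x y ex ey|u v].
- by rewrite !tensr0 addr0.
- by rewrite !tensrDl ex ey addrACA.
- by rewrite !tensr_tens rscaleDr tensDr.
Qed.
HB.instance Definition _ := isRightModule.Build T W
  tensrA tensr1 tensrDl tensrDr.
Lemma rscale_tens (u : U) (v : V) (t : T) :
  rscale (tens u v) t = tens u (rscale v t : V).
Proof. exact: tensr_tens. Qed.
End TensorRmod.

Section TensorBimod.
Variables (R S T : pzRingType) (U : bimodType R S) (V : bimodType S T).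
Fact tens_bimod (r : R) (x : tensor U V) (t : T) :
  r *: (rscale x t) = rscale (r *: x) t.
Proof.
elim/tensor_ind: x => [|x y ex ey|u v].
- by rewrite rscale0l !scaler0 rscale0l.
- by rewrite rscaleDl !scalerDr rscaleDl ex ey.
- by rewrite rscale_tens !scale_tens rscale_tens.
Qed.
HB.instance Definition _ := isBimodule.Build R T (tensor U V) tens_bimod.
End TensorBimod.

Definition tmap (S : pzRingType) (U : rmodType S) (V W : lmodType S)
    (d : {linear V -> W}) : tensor U V -> tensor U W :=
  tlift (fun u v => tens u (d v)).

Lemma tmap_bal (S : pzRingType) (U : rmodType S) (V W : lmodType S)
    (d : {linear V -> W}) : balanced (fun (u : U) v => tens u (d v)).
Proof.
by split=> *; rewrite ?linearD ?tensDl ?tensDr // linearZ tens_bal.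
Qed.

(* Cohomological indexing, d^i : P^i -> P^(i+1). The index is written 1 + i     *)
(* because 1 + i, unlike i + 1, computes on the constructors of int. *)
Record complex (R : pzRingType) := Complex {
  cterm :> int -> lmodType R;
  cdiff : forall i : int, {linear cterm i -> cterm (1 + i)};
  cdiffK : forall (i : int) (x : cterm i), cdiff (1 + i) (cdiff i x) = 0
}.
Arguments cdiff {R} c i.

Section Exactness.
Variables (R : pzRingType) (P : complex R).

Definition exact_cx : Prop :=
  forall (i : int) (y : P (1 + i)),
    cdiff P (1 + i) y = 0 -> exists x : P i, cdiff P i x = y.

(* exactness of Hom_R(P, U) at Hom_R(P^(i+1), U), for all i *)
Definition hom_exact (U : lmodType R) : Prop :=
  forall (i : int) (h : {linear P (1 + i) -> U}),
    (forall x : P i, h (cdiff P i x) = 0) ->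
    exists k : {linear P (1 + (1 + i)) -> U},
      forall y : P (1 + i), k (cdiff P (1 + i) y) = h y.

(* exactness of the tensor product of U and P over R *)
Definition tensor_exact (U : rmodType R) : Prop :=
  forall (i : int) (y : tensor U (P (1 + i))),
    tmap (cdiff P (1 + i)) y = 0 -> exists x, tmap (cdiff P i) x = y.

Definition totally_exact : Prop := exact_cx /\ hom_exact R^o.

Definition fg_projective_terms : Prop :=
  forall i, fin_gen (P i) /\ projective (P i).
End Exactness.

(* Modules are finitely generated throughout, hence so are the terms of P. *)
Definition gorenstein_projective (R : pzRingType) (X : lmodType R) : Prop :=
  exists P : complex R, [/\ fg_projective_terms P, totally_exact P
    & lmod_iso X (submod (ker (cdiff P 0)))].

Definition weakly_compatible (R S : pzRingType) (U : bimodType R S) : Prop :=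
  (forall P : complex R, fg_projective_terms P -> totally_exact P ->
     hom_exact P U) /\
  (forall Q : complex S, fg_projective_terms Q -> totally_exact Q ->
     tensor_exact Q U).

(* The trivial extension of G by J; the multiplication is [te_mul]. *)
Definition trivext (G : pzRingType) (J : Type) : Type := (G * J)%type.

Section TrivExt.
Variables (G : pzRingType) (J : bimodType G G).
Local Notation B := (trivext G J).
HB.instance Definition _ := GRing.Zmodule.copy B (G * J)%type.
Definition te_one : B := (1, 0).
Definition te_mul (x y : B) : B := (x.1 * y.1, x.1 *: y.2 + rscale x.2 y.1).
Fact te_mulA : associative te_mul.
Proof.
move=> [b j] [b' j'] [b'' j'']; rewrite /te_mul /= mulrA; congr (_, _).
by rewrite scalerDr rscaleDl scalerA rscaleA scale_rscale addrA.
Qed.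
Fact te_mul1 : left_id te_one te_mul.
Proof. by move=> [b j]; rewrite /te_mul /= mul1r scale1r rscale0l addr0. Qed.
Fact te_mulr1 : right_id te_one te_mul.
Proof. by move=> [b j]; rewrite /te_mul /= mulr1 rscale1 scaler0 add0r. Qed.
Fact te_mulDl : left_distributive te_mul +%R.
Proof.
move=> [b j] [b' j'] [c k]; rewrite /te_mul /=; congr (_, _) => /=.
  by rewrite mulrDl.
by rewrite scalerDl rscaleDl addrACA.
Qed.
Fact te_mulDr : right_distributive te_mul +%R.
Proof.
move=> [c k] [b j] [b' j']; rewrite /te_mul /=; congr (_, _) => /=.
  by rewrite mulrDr.
by rewrite scalerDr rscaleDr addrACA.
Qed.
HB.instance Definition _ := GRing.Zmodule_isPzRing.Build B
  te_mulA te_mul1 te_mulr1 te_mulDl te_mulDr.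

Definition te_inj (b : G) : B := (b, 0).
Definition te_proj (x : B) : G := x.1.
Definition te_ideal (j : J) : B := (0, j).

Lemma te_proj_ideal j : te_proj (te_ideal j) = 0.
Proof. by []. Qed.
Lemma te_ideal0 : te_ideal 0 = 0.
Proof. by []. Qed.
Lemma te_idealD j k : te_ideal (j + k) = te_ideal j + te_ideal k.
Proof. by congr (_, _); rewrite /= addr0. Qed.
Lemma te_mul_ideal (b : B) j : b * te_ideal j = te_ideal (te_proj b *: j).
Proof. by congr (_, _); rewrite /= ?mulr0 // rscale0r addr0. Qed.
Lemma te_ideal_mul (b : B) j : te_ideal j * b = te_ideal (rscale j (te_proj b)).
Proof. by congr (_, _); rewrite /= ?mul0r // scale0r add0r. Qed.

Fact te_inj_zmod : zmod_morphism te_inj.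
Proof. by move=> b c; congr (_, _); rewrite /= subr0. Qed.
HB.instance Definition _ := GRing.isZmodMorphism.Build G B te_inj te_inj_zmod.
Fact te_inj_monoid : monoid_morphism te_inj.
Proof. by split=> // b c; congr (_, _); rewrite /= scaler0 rscale0l addr0. Qed.
HB.instance Definition _ := GRing.isMonoidMorphism.Build G B te_inj te_inj_monoid.
Fact te_proj_zmod : zmod_morphism te_proj.
Proof. by []. Qed.
HB.instance Definition _ := GRing.isZmodMorphism.Build B G te_proj te_proj_zmod.
Fact te_proj_monoid : monoid_morphism te_proj.
Proof. by []. Qed.
HB.instance Definition _ := GRing.isMonoidMorphism.Build B G te_proj te_proj_monoid.

(* JY: finite sums of products, J being embedded in B by [te_ideal] *)
Section IdealMul.
Variable Y : lmodType B.
Definition ideal_mul : {pred Y} :=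
  [pred y | `[< exists s : seq (J * Y), y = \sum_(p <- s) te_ideal p.1 *: p.2 >]].
Fact ideal_mul_closed : subsemimod_closed ideal_mul.
Proof.
split; [split|]; first by apply/asboolP; exists [::]; rewrite big_nil.
  move=> x y /asboolP[s ->] /asboolP[t ->].
  by apply/asboolP; exists (s ++ t); rewrite big_cat.
move=> a x /asboolP[s ->]; apply/asboolP.
exists [seq (a.1 *: p.1, p.2) | p <- s]; rewrite big_map scaler_sumr.
apply: eq_bigr => p _; rewrite scalerA; congr (_ *: _); congr (_, _) => /=.
  by rewrite mulr0.
by rewrite rscale0r addr0.
Qed.
HB.instance Definition _ := GRing.isSubmodClosed.Build B Y ideal_mul ideal_mul_closed.
End IdealMul.
End TrivExt.
#[global] Arguments ideal_mul {G J} Y.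
#[global] Arguments te_inj {G J} b : simpl never.
#[global] Arguments te_proj {G J} x : simpl never.
#[global] Arguments te_ideal {G J} j : simpl never.

(* ((a, n), (m, b)) stands for the matrix with rows (a n) and (m b), where b is *)
(* in B = [trivext G J]. With b = (b1, j) and b' = (b2, j'), the lower right    *)
(* entry of [nct_mul] is (b1 * b2, m (x) n' + b1 *: j' + rscale j b2), since    *)
(* te_ideal t = (0, t). *)
Definition nctensor (A G : pzRingType) (M : bimodType G A) (N : bimodType A G) : Type :=
  ((A * N) * (M * trivext G (tensor M N)))%type.

Section NCTensor.
Variables (A G : pzRingType) (M : bimodType G A) (N : bimodType A G).
Local Notation J := (tensor M N).
Local Notation B := (trivext G J).
Local Notation C := (nctensor M N).
HB.instance Definition _ := GRing.Zmodule.copy C ((A * N) * (M * B))%type.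

Definition nct_one : C := ((1, 0), (0, 1)).
Definition nct_mul (x y : C) : C :=
  let: ((a, n), (m, b)) := x in
  let: ((a', n'), (m', b')) := y in
  ((a * a', a *: n' + rscale n (te_proj b')),
   (rscale m a' + te_proj b *: m', te_ideal (tens m n' : J) + b * b')).

Fact nct_mulA : associative nct_mul.
Proof.
move=> [[a n] [m b]] [[a' n'] [m' b']] [[a'' n''] [m'' b'']] /=.
congr ((_, _), (_, _)).
- by rewrite mulrA.
- rewrite (rmorphD (@te_proj G J)) rmorphM /= te_proj_ideal add0r.
  by rewrite scalerDr scalerA rscaleDl scale_rscale addrA rscaleA.
- rewrite (rmorphD (@te_proj G J)) rmorphM /= te_proj_ideal add0r.
  by rewrite !rscaleDl rscaleA scalerDr scalerA scale_rscale addrA.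
- rewrite mulrDr mulrDl mulrA te_mul_ideal te_ideal_mul rscale_tens scale_tens.
  rewrite tensDr tensDl tens_bal !te_idealD !addrA; congr (_ + _).
  by rewrite addrAC.
Qed.
Fact nct_mul1 : left_id nct_one nct_mul.
Proof.
move=> [[a n] [m b]] /=; rewrite rmorph1 !mul1r !scale1r rscale0l addr0.
by rewrite rscale0l add0r tens0l te_ideal0 add0r.
Qed.
Fact nct_mulr1 : right_id nct_one nct_mul.
Proof.
move=> [[a n] [m b]] /=; rewrite rmorph1 !mulr1 !rscale1 !scaler0 add0r.
by rewrite addr0 tens0r te_ideal0 add0r.
Qed.
Fact nct_mulDl : left_distributive nct_mul +%R.
Proof.
move=> [[a n] [m b]] [[a' n'] [m' b']] [[a'' n''] [m'' b'']].
congr ((_, _), (_, _)) => /=.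
- by rewrite mulrDl.
- by rewrite scalerDl rscaleDl addrACA.
- by rewrite (rmorphD (@te_proj G J)) scalerDl rscaleDl addrACA.
- by rewrite tensDl te_idealD mulrDl addrACA.
Qed.
Fact nct_mulDr : right_distributive nct_mul +%R.
Proof.
move=> [[a n] [m b]] [[a' n'] [m' b']] [[a'' n''] [m'' b'']].
congr ((_, _), (_, _)) => /=.
- by rewrite mulrDr.
- by rewrite (rmorphD (@te_proj G J)) scalerDr rscaleDr addrACA.
- by rewrite scalerDr rscaleDr addrACA.
- by rewrite tensDr te_idealD mulrDr addrACA.
Qed.
HB.instance Definition _ := GRing.Zmodule_isPzRing.Build C
  nct_mulA nct_mul1 nct_mulr1 nct_mulDl nct_mulDr.
End NCTensor.

(* M as a B-A-bimodule, N as an A-B-bimodule and J as a B-B-bimodule, via    *)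
(* B -> G. On J this is the structure of the ideal 0 + J of B, as J^2 = 0.    *)
Notation left_over_B M N := (resl (@te_proj _ (tensor M N)) M).
Notation right_over_B M N := (resr (@te_proj _ (tensor M N)) N).
Notation ideal_over_B M N :=
  (resl (@te_proj _ (tensor M N)) (resr (@te_proj _ (tensor M N)) (tensor M N))).

Section Quadruple.
Variables (A G : pzRingType) (M : bimodType G A) (N : bimodType A G).
Local Notation J := (tensor M N).
Local Notation B := (trivext G J).
Local Notation MB := (left_over_B M N).
Local Notation NB := (right_over_B M N).
Variables (X : lmodType A) (Y : lmodType B).
Variables (f : {linear tensor MB X -> Y}) (g : {linear tensor NB Y -> X}).

Definition is_quadruple : Prop :=
  (forall (n : NB) (m : MB) (x : X), g (tens n (f (tens m x))) = 0) /\
  (forall (m : MB) (n : NB) (y : Y),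
     f (tens m (g (tens n y))) = te_ideal (tens (m : M) (n : N)) *: y).

(* JY is contained in Im(f), so that [sub_inside (im f) JY] is JY. *)
Lemma ideal_mul_sub_im : is_quadruple ->
  forall y, y \in ideal_mul Y -> y \in im f.
Proof.
case=> _ fgE y /asboolP[s ->]; apply: rpred_sum => -[j z] _ /=.
elim/tensor_ind: j => [|j k Pj Pk|m n].
- by rewrite te_ideal0 scale0r rpred0.
- by rewrite te_idealD scalerDl rpredD.
- by rewrite -fgE; apply/asboolP; exists (tens (m : MB) (g (tens (n : NB) z))).
Qed.

(* J Coker(f) = 0, so the B-module structure of Coker(f) comes from the      *)
(* G-module obtained by restricting it along G -> B.                         *)
Lemma coker_ideal : is_quadruple ->
  forall (j : J) (z : coker f), te_ideal j *: z = 0.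
Proof.
move=> fgP j z; rewrite -[z]quotmod_reprK -[LHS]quotmod_piZ.
apply/eqP; rewrite quotmod_pi_eq0; apply: (ideal_mul_sub_im fgP).
by apply/asboolP; exists [:: (j, quotmod_repr z)]; rewrite big_seq1.
Qed.

(* the C-module of columns (x y) *)
Definition quad_mod (fgP : is_quadruple) : Type := (X * Y)%type.

Section QuadMod.
Hypothesis fgP : is_quadruple.
Local Notation C := (nctensor M N).
Local Notation Z := (quad_mod fgP).
HB.instance Definition _ := GRing.Zmodule.copy Z (X * Y)%type.
Definition quad_scale (c : C) (z : Z) : Z :=
  let: ((a, n), (m, b)) := c in
  (a *: z.1 + g (tens (n : NB) z.2), f (tens (m : MB) z.1) + b *: z.2).
Fact quad_scaleA c d z : quad_scale c (quad_scale d z) = quad_scale (c * d) z.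
Proof.
case: fgP => gf0 fgE.
case: c d z => [[a n] [m b]] [[a' n'] [m' b']] [x y] /=; congr (_, _) => /=.
- rewrite scalerDr scalerA !tensDr !linearD /= gf0 add0r tensDl linearD /=.
  rewrite -addrA; congr (_ + _); congr (_ + _).
    by rewrite -linearZ scale_tens.
  by rewrite -tens_bal.
- rewrite scalerDr scalerA !tensDr !tensDl !linearD /= fgE scalerDl.
  rewrite (tens_bal (m : MB)) -!addrA; congr (_ + _).
  rewrite addrCA; congr (_ + _).
  by rewrite -linearZ scale_tens.
Qed.
Fact quad_scale1 : left_id 1 quad_scale.
Proof.
move=> [x y]; rewrite /quad_scale /= !scale1r tens0l tens0l !linear0.
by rewrite addr0 add0r.
Qed.
Fact quad_scaleDr : right_distributive quad_scale +%R.
Proof.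
move=> [[a n] [m b]] [x y] [x' y']; congr (_, _) => /=.
- by rewrite scalerDr tensDr linearD addrACA.
- by rewrite scalerDr tensDr linearD addrACA.
Qed.
Fact quad_scaleDl z : {morph quad_scale^~ z : c d / c + d}.
Proof.
move=> [[a n] [m b]] [[a' n'] [m' b']]; congr (_, _) => /=.
- by rewrite scalerDl (tensDl (n : NB)) linearD addrACA.
- by rewrite scalerDl (tensDl (m : MB)) linearD addrACA.
Qed.
HB.instance Definition _ := GRing.Zmodule_isLmodule.Build C Z
  quad_scaleA quad_scale1 quad_scaleDr quad_scaleDl.
End QuadMod.
End Quadruple.

(* Main.v *)
Require Import Defs.
From HB Require Import structures.
From mathcomp Require Import all_boot all_order all_algebra.
From mathcomp Require Import boolp.
Set Implicit Arguments.
Unset Strict Implicit.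
Unset Printing Implicit Defensive.
Import GRing.Theory.
Local Open Scope ring_scope.

(** Write [V = coker f] and [U = coker g], and let [Q] and [P] be totally
    exact complexes of finitely generated projective modules over [G] and [A]
    whose zeroth cocycles are [V] and [U].

    The isomorphisms in the hypotheses are arbitrary, but they compare the
    target of a canonical surjection with its source: [N (x) V -> im g],
    [M (x) U -> im f / JY] and [J (x) V -> JY]. These sources are finitely
    generated over [A] or [G], and a surjective endomorphism of a noetherian
    module is injective ([noetherian_hopfian]), so the canonical surjections
    are themselves bijective ([gG_inj], [fU_inj], [jG_inj]). Right exactness
    of [M (x) -] then shows that [M (x) X -> Y] is injective ([fG_inj]). In
    other words, there are short exact sequences [0 -> N (x) V -> X -> U -> 0]
    and [0 -> M (x) X -> Y -> V -> 0].

    The horseshoe lemma ([horseshoe]) realizes the first one as the zeroth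
    cocycles of a complex with terms [X^i = P^i + N (x) Q^i], and then the
    second one as the zeroth cocycles of a complex with terms
    [Y^i = Q^i + M (x) X^i]. Weak compatibility is what the lemma needs: it
    makes [N (x) Q] and [M (x) X^i] exact, and it makes [Hom(P, N (x) Q^i)]
    and [Hom(Q, M (x) X^i)] exact, because the coefficient modules are
    summands of finite sums of copies of [N], [M] and [M (x) N].

    The pair [(X^i, Y^i)] is the [C]-module [induced] from [(P^i, Q^i)]. By
    its universal property ([induced_lift]) it is projective, and a map from
    it to [C] is a pair of maps on [P^i] and [Q^i] with values in the rows of
    [C]. Filtering [C] by the layers [G], [A + N] and [M + J] reduces the
    exactness of Hom into [C] to that of Hom from [P] to [A] and [N] and from
    [Q] to [G], [M] and [M (x) N] ([induced_totally_exact]). Finally the two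
    embeddings given by the horseshoe lemma fit together into a [C]-linear
    identification of [(X, Y)] with the zeroth cocycles ([resolve_kernel]). *)

(** * Linear maps and projective modules *)

Definition lin_of (R : pzRingType) (U V : lmodType R) (f : U -> V)
  (H : linear f) : {linear U -> V} := HB.pack f (GRing.isLinear.Build R U V _ f H).
Lemma lin_ofE (R : pzRingType) (U V : lmodType R) (f : U -> V)
  (H : linear f) x : lin_of H x = f x.
Proof. by []. Qed.

Section Lift.
Variables (R S : pzRingType) (U : bimodType R S) (V : lmodType S).
Variables (W : lmodType R) (h : U -> V -> W).
Hypothesis hB : balanced h.
Hypothesis hZ : forall r u v, h (r *: u) v = r *: h u v.
Fact tlift_linear : linear (tlift h : tensor U V -> W).
Proof.
move=> a x y; rewrite (tliftD hB); congr (_ + _).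
elim/tensor_ind: x => [|x1 x2 e1 e2|u v].
- by rewrite scaler0 (tlift0 hB) scaler0.
- by rewrite scalerDr !(tliftD hB) e1 e2 scalerDr.
- by rewrite scale_tens !(tlift_tens hB) hZ.
Qed.
Definition tliftL : {linear tensor U V -> W} := lin_of tlift_linear.
Lemma tliftL_tens u v : tliftL (tens u v) = h u v.
Proof. exact: (tlift_tens hB). Qed.
End Lift.

(** Corestricting both maps to the image of [a] turns the hypothesis into an
    honest lifting problem along a surjection. *)
Lemma projective_lift (R : pzRingType) (P V W : lmodType R)
    (a : {linear V -> W}) (h : {linear P -> W}) :
  projective P -> (forall x, exists v, a v = h x) ->
  exists k : {linear P -> V}, forall x, a (k x) = h x.
Proof.
move=> prP ah.
have imP v : a v \in im a by apply/asboolP; exists v.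
have imh x : h x \in im a by have [v <-] := ah x.
have al : linear (fun v => Sub (a v) (imP v) : submod (im a)).
  by move=> c u v; apply: val_inj => /=; rewrite linearP.
have hl : linear (fun x => Sub (h x) (imh x) : submod (im a)).
  by move=> c u v; apply: val_inj => /=; rewrite linearP.
have [|k kE] := prP _ _ (lin_of al) (lin_of hl).
  by case=> w wP; have /asboolP[v vw] := wP; exists v; apply: val_inj.
by exists k => x; have /(congr1 val) := kE x.
Qed.

(** The surjection from [R^n] given by generators splits, and the components of
    a splitting are coordinate functionals. All later arguments about finitely
    generated projective modules use these coordinates only. *)
Lemma dual_basis (R : pzRingType) (P : lmodType R) :
  fin_gen P -> projective P ->
  exists n (e : 'I_n -> P) (c : 'I_n -> {linear P -> R^o}),
    forall x, x = \sum_i (c i x : R) *: e i.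
Proof.
case=> n [e eP] prP; exists n, e.
have sl : linear (fun v : 'rV[R]_n => \sum_i v 0 i *: e i).
  move=> a u v; rewrite scaler_sumr -big_split; apply: eq_bigr => i _.
  by rewrite !mxE scalerDl scalerA.
have idl : linear (@id P) by [].
have [|k kE] := prP _ _ (lin_of sl) (lin_of idl).
  move=> x; have [c ->] := eP x; exists (\row_i c i).
  by apply: eq_bigr => i _; rewrite mxE.
have cl i : linear (fun x => k x 0 i : R^o).
  by move=> a u v; rewrite linearP !mxE.
by exists (fun i => lin_of (cl i)) => x; rewrite -[LHS](kE x).
Qed.

(** * Twisted sums of complexes and the horseshoe lemma *)

Lemma factor_surj (R : pzRingType) (V W Z : lmodType R)
    (q : {linear V -> W}) (h : {linear V -> Z}) :
  (forall w, exists v, q v = w) -> (forall v, q v = 0 -> h v = 0) ->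
  exists k : {linear W -> Z}, forall v, k (q v) = h v.
Proof.
move=> q_surj qh; pose s w := projT1 (cid (q_surj w)).
have sE w : q (s w) = w by rewrite /s; case: cid.
have hE v w : q v = q w -> h v = h w.
  by move=> e; apply/eqP; rewrite -subr_eq0 -linearB qh // linearB e subrr.
have kl : linear (fun w => h (s w)).
  by move=> a u v; rewrite -linearP; apply: hE; rewrite sE linearP !sE.
by exists (lin_of kl) => v; apply: hE; rewrite sE.
Qed.

Lemma dep_choice (T : nat -> Type) (r : forall n, T n -> T n.+1 -> Prop)
    (x0 : T 0%N) :
  (forall n (x : T n), exists y, r n x y) ->
  exists s : forall n, T n, s 0%N = x0 /\ forall n, r n (s n) (s n.+1).
Proof.
move=> h; pose s := nat_rect T x0 (fun n x => projT1 (cid (h n x))).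
by exists s; split=> // n; rewrite /s /=; case: cid.
Qed.

(** [b] identifies [L] with the zeroth cocycles of [P]; it is kept as an
    embedding into [P 0] because the horseshoe lemma extends such embeddings. *)
Definition kernel_map (R : pzRingType) (P : complex R) (L : lmodType R)
    (b : {linear L -> P 0}) :=
  injective b /\ forall y, cdiff P 0 y = 0 <-> exists l, b l = y.

Definition short_exact (R : pzRingType) (K W L : lmodType R)
    (i : {linear K -> W}) (p : {linear W -> L}) :=
  [/\ injective i, forall w, p w = 0 <-> exists k, i k = w
    & forall l, exists w, p w = l].

(** Every index is a successor in [int], so exactness of the Hom complex extends
    a map killing the cocycles of [P i] for any [i]. *)
Lemma hom_exact_extend (R : pzRingType) (P : complex R) (U : lmodType R)
    (i : int) (h : {linear P i -> U}) :
  hom_exact P U -> (forall y, cdiff P i y = 0 -> h y = 0) ->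
  exists k : {linear P (1 + i) -> U}, forall y, k (cdiff P i y) = h y.
Proof.
have [j ij] : exists j, i = 1 + j by exists (i - 1); rewrite addrC subrK.
move: h; rewrite ij => h hom hd; apply: hom => x; apply: hd; exact: cdiffK.
Qed.

Lemma linear_inj0 (R : pzRingType) (U V : lmodType R) (f : {linear U -> V}) :
  (forall x, f x = 0 -> x = 0) -> injective f.
Proof.
move=> f0 x y e; apply/eqP; rewrite -subr_eq0; apply/eqP/f0.
by rewrite linearB e subrr.
Qed.

Section Horseshoe.
Variables (R : pzRingType) (P E : complex R).

(** The off-diagonal entry of a differential on [P i * E i] for which [E] is a
    subcomplex and [P] the quotient; the equation says that the differential
    squares to zero. *)
Definition twisting (t : forall i, {linear P i -> E (1 + i)}) :=
  forall i x, cdiff E (1 + i) (t i x) + t (1 + i) (cdiff P i x) = 0.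

Section Twisted.
Variables (t : forall i, {linear P i -> E (1 + i)}) (tP : twisting t).

Definition twisted_diff i (z : P i * E i) : P (1 + i) * E (1 + i) :=
  (cdiff P i z.1, t i z.1 + cdiff E i z.2).
Fact twisted_diff_linear i : linear (@twisted_diff i).
Proof.
move=> a [x e] [y e']; congr (_, _) => /=; rewrite ?linearP //=.
by rewrite scalerDr addrACA.
Qed.
Fact twisted_diffK i z :
  lin_of (@twisted_diff_linear (1 + i)) (lin_of (@twisted_diff_linear i) z) = 0.
Proof.
congr (_, _) => /=; first exact: cdiffK.
by rewrite linearD /= cdiffK addr0 -[RHS](tP z.1); apply: addrC.
Qed.
Definition twisted : complex R := Complex twisted_diffK.
End Twisted.

Hypothesis prP : forall i, projective (P i).
Hypothesis exP : exact_cx P.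
Hypothesis exE : exact_cx E.
Hypothesis homPE : forall i, hom_exact P (E i).

(** The invariant that lets one component of a twisting determine both of its
    neighbours. *)
Definition cocyclic i (t : {linear P i -> E (1 + i)}) :=
  forall y, cdiff P i y = 0 -> cdiff E (1 + i) (t y) = 0.
Definition twist_step i (t : {linear P i -> E (1 + i)})
    (t' : {linear P (1 + i) -> E (1 + (1 + i))}) :=
  forall x, cdiff E (1 + i) (t x) + t' (cdiff P i x) = 0.

(** The map [x |-> - d (t x)] kills cocycles, so it extends along the
    differential of [P], as [Hom(P, E)] is exact. *)
Lemma twist_up i t : cocyclic t ->
  exists t', @cocyclic (1 + i) t' /\ @twist_step i t t'.
Proof.
move=> ct; have hl : linear (fun x => - cdiff E (1 + i) (t x)).
  by move=> a u v; rewrite !linearP.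
have [|t' t'E] := hom_exact_extend (h := lin_of hl) (@homPE _).
  by move=> y dy; rewrite lin_ofE ct ?oppr0.
exists t'; split=> [y /exP[x <-]|x]; last by rewrite t'E lin_ofE subrr.
by rewrite t'E lin_ofE linearN /= cdiffK oppr0.
Qed.

(** The map [- t' d] takes its values in cocycles, hence in coboundaries of [E],
    and [P i] is projective. *)
Lemma twist_down i t' : @cocyclic (1 + i) t' ->
  exists t, @cocyclic i t /\ @twist_step i t t'.
Proof.
move=> ct; have hl : linear (fun x => - t' (cdiff P i x)).
  by move=> a u v; rewrite !linearP.
have [|t tE] := projective_lift (a := cdiff E (1 + i)) (h := lin_of hl) (@prP i).
  move=> x; apply: exE; rewrite lin_ofE linearN /= ct ?oppr0 //; exact: cdiffK.
exists t; split=> [y dy|x]; rewrite tE lin_ofE ?addNr //.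
by rewrite dy linear0 oppr0.
Qed.

Lemma extend_twisting (t : {linear P (Negz 0) -> E (1 + Negz 0)}) :
  cocyclic t -> exists t', twisting t' /\ t' (Negz 0) = t.
Proof.
move=> ct.
have [u0 [cu0 u0t]] := @twist_up (Negz 0) t ct.
have [v0 [cv0 v0t]] := @twist_down (Negz 1) t ct.
(* [1 + Negz n.+2] computes to [Negz n.+1], whereas [1 + Negz n.+1] does not
   compute to [Negz n] for a variable [n]; so the two components next to [t] are
   built by hand and the descending sequence starts at index -2. *)
pose T i := {t | @cocyclic i t}.
have [u [uE uS]] := dep_choice
  (r := fun n (x : T (Posz n)) (y : T (Posz n.+1)) =>
     @twist_step (Posz n) (sval x) (sval y))
  (exist _ u0 cu0)
  (fun n x => let: ex_intro y (conj cy xy) := twist_up (svalP x) in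
     ex_intro _ (exist _ y cy) xy).
have [v [vE vS]] := dep_choice
  (r := fun n (x : T (Negz n.+1)) (y : T (Negz n.+2)) =>
     @twist_step (Negz n.+2) (sval y) (sval x))
  (exist _ v0 cv0)
  (fun n x => let: ex_intro y (conj cy xy) := @twist_down (Negz n.+2) _ (svalP x) in
     ex_intro _ (exist _ y cy) xy).
exists (fun i => match i return {linear P i -> E (1 + i)} with
  | Posz n => sval (u n) | Negz 0 => t | Negz n.+1 => sval (v n) end).
split=> // -[n|[|[|n]]] x.
- exact: uS.
- have := u0t x; have -> : u0 = sval (u 0%N) by rewrite uE. by [].
- have := v0t x; have -> : v0 = sval (v 0%N) by rewrite vE. by [].
- exact: vS.
Qed.

Variables (K W L : lmodType R) (i : {linear K -> W}) (p : {linear W -> L}).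
Variables (a : {linear K -> E 0}) (b : {linear L -> P 0}).
Hypotheses (ip : short_exact i p) (aK : kernel_map a) (bK : kernel_map b).

(** If [L] and [K] are the zeroth cocycles of [P] and [E], then an extension [W]
    of [L] by [K] is the zeroth cocycles of a twisted sum of [P] and [E]. The
    map from [P (-1)] onto [L] lifts to [s : P (-1) -> W]; on boundaries [s]
    falls into [K], and extending the resulting map [P (-2) -> K -> E 0] to
    [P (-1)] gives the component [t] of the twisting in degree -1. Since [W] is
    generated by the images of [s] and [K], the maps [t] and [a] glue to the
    second component of an embedding of [W]. *)
Theorem horseshoe : exists t (tP : twisting t) (c : {linear W -> twisted tP 0}),
  [/\ kernel_map c, forall w, (c w).1 = b (p w) & forall k, c (i k) = (0, a k)].
Proof.
case: ip => i_inj pi0 p_surj; case: aK => a_inj aE; case: bK => b_inj bE.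
have da k : cdiff E 0 (a k) = 0 by apply/aE; exists k.
have db l : cdiff P 0 (b l) = 0 by apply/bE; exists l.
have bpl : linear (fun w => b (p w)) by move=> r x y; rewrite !linearP.
(* [s] lifts the corestricted differential [P (-1) -> L]. *)
have [s sE] : exists s : {linear P (Negz 0) -> W},
    forall x, b (p (s x)) = cdiff P (Negz 0) x.
  apply: (@projective_lift _ _ _ _ (lin_of bpl)) => // x.
  have /bE[l lE] := @cdiffK _ P (Negz 0) x.
  by have [w wl] := p_surj l; exists w; rewrite lin_ofE wl.
have sdl : linear (fun x => s (cdiff P (Negz 1) x)).
  by move=> r x y; rewrite !linearP.
have [q qE] : exists q : {linear P (Negz 1) -> K},
    forall x, i (q x) = s (cdiff P (Negz 1) x).
  apply: (@projective_lift _ _ _ _ _ (lin_of sdl)) => // x; apply/pi0/b_inj.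
  by rewrite sE linear0; apply: (@cdiffK _ P (Negz 1)).
have aql : linear (fun x => a (q x)) by move=> r x y; rewrite !linearP.
(* This is where the vanishing of Ext^1(L, E 0) is used. *)
have [|t tE] := @hom_exact_extend _ P (E 0) (Negz 1) (lin_of aql) (@homPE _).
  move=> y dy; rewrite lin_ofE.
  by have -> : q y = 0; [apply: i_inj; rewrite qE dy !linear0 | rewrite linear0].
have exP0 x : cdiff P (Negz 0) x = 0 -> exists y, x = cdiff P (Negz 1) y.
  by move=> /(@exP (Negz 1))[y <-]; exists y.
have ct : @cocyclic (Negz 0) t.
  by move=> x /exP0[y ->]; rewrite [t _]tE; apply: da.
have [u [tw uE]] := extend_twisting ct.
have ul : linear (fun z : P (Negz 0) * K => s z.1 + i z.2).
  by move=> r x y; rewrite !linearP /= scalerDr addrACA.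
have vl : linear (fun z : P (Negz 0) * K => t z.1 + a z.2).
  by move=> r x y; rewrite !linearP /= scalerDr addrACA.
have ul_surj w : exists z, lin_of ul z = w.
  have [x xE] : exists x, cdiff P (Negz 0) x = b (p w).
    by apply: (@exP (Negz 0)); apply: db.
  have /pi0[k kE] : p (w - s x) = 0.
    by apply: b_inj; rewrite !linearB sE xE subrr linear0.
  by exists (x, k); rewrite lin_ofE /= kE addrC subrK.
have [|c cE] := factor_surj (q := lin_of ul) (h := lin_of vl) ul_surj.
  move=> [x k]; rewrite !lin_ofE /= => /eqP; rewrite addr_eq0 => /eqP e.
  have /exP0[y yE] : cdiff P (Negz 0) x = 0.
    rewrite -sE e linearN /=; have -> : p (i k) = 0 by apply/pi0; exists k.
    by rewrite oppr0 linear0.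
  rewrite yE [t _]tE lin_ofE -linearD.
  suff -> : q y + k = 0 by rewrite linear0.
  by apply: i_inj; rewrite linearD qE -yE e addNr linear0.
have ci k : c (i k) = a k.
  by have := cE (0, k); rewrite !lin_ofE /= !linear0 !add0r.
have ccl : linear (fun w => (b (p w), c w)).
  by move=> r x y; rewrite !linearP.
exists u, tw, (lin_of ccl : {linear W -> twisted tw 0}).
split=> //; last first.
  move=> k; rewrite lin_ofE ci; congr (_, _).
  by have -> : p (i k) = 0; [apply/pi0; exists k | rewrite linear0].
have uc w : u 0 (b (p w)) + cdiff E 0 (c w) = 0.
  have [[x k] <-] := ul_surj w; rewrite cE !lin_ofE /=.
  have -> : b (p (s x + i k)) = cdiff P (Negz 0) x.
    rewrite linearD; have -> : p (i k) = 0 by apply/pi0; exists k.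
    by rewrite addr0 sE.
  by rewrite linearD da addr0 -[RHS](tw (Negz 0) x) uE; apply: addrC.
split.
  apply: linear_inj0 => w; rewrite lin_ofE => -[e1 e2].
  have /pi0[k kE] : p w = 0 by apply: b_inj; rewrite linear0.
  rewrite -kE; have -> : k = 0; last by rewrite linear0.
  by apply: a_inj; rewrite -ci kE e2 linear0.
move=> [x e]; split=> [[dx de]|[w <-]]; last first.
  by congr (_, _) => /=; [apply: db | apply: uc].
have /bE[l lE] := dx; have [w wl] := p_surj l.
have /aE[k kE] : cdiff E 0 (e - c w) = 0.
  have := uc w; rewrite wl lE => /eqP; rewrite addr_eq0 => /eqP uw.
  by rewrite linearB -[cdiff E 0 (c w)]opprK -uw opprK -[RHS]de; apply: addrC.
exists (w + i k); rewrite lin_ofE; congr (_, _).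
  have -> : p (w + i k) = p w; last by rewrite wl lE.
  by rewrite linearD; have -> : p (i k) = 0; [apply/pi0; exists k | rewrite addr0].
by rewrite linearD ci kE addrC subrK.
Qed.
End Horseshoe.

(** * Surjective endomorphisms over noetherian rings *)

Section Hopfian.
Variables (R : pzRingType) (V : lmodType R).

(** The span by recursion on the list of generators, which is the shape needed
    for the induction in [noetherian_span]. *)
Fixpoint in_span (s : seq V) (v : V) : Prop :=
  if s is e :: s' then exists r : R, in_span s' (v - r *: e) else v = 0.

Lemma in_spanP s (c d : R) u v :
  in_span s u -> in_span s v -> in_span s (c *: u + d *: v).
Proof.
elim: s u v => [|e s IHs] u v /=; first by move=> -> ->; rewrite !scaler0 addr0.
move=> [a ua] [b vb]; exists (c * a + d * b).
rewrite (_ : _ - _ = c *: (u - a *: e) + d *: (v - b *: e)); first exact: IHs.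
by rewrite !scalerBr !scalerA scalerDl opprD addrACA.
Qed.

Lemma in_span0 s : in_span s 0.
Proof. by elim: s => //= e s IHs; exists 0; rewrite scale0r subr0. Qed.

Lemma in_span_cons s e v : in_span s v -> in_span (e :: s) v.
Proof. by exists 0; rewrite scale0r subr0. Qed.

Lemma in_span_mem s v : v \in s -> in_span s v.
Proof.
elim: s => //= e s IHs; rewrite inE => /orP[/eqP->|/IHs]; last exact: in_span_cons.
by exists 1; rewrite scale1r subrr; apply: in_span0.
Qed.

Lemma in_span_sub s (S : submodClosed V) v :
  {subset s <= S} -> in_span s v -> v \in S.
Proof.
elim: s v => [|e s IHs] v sS /=; first by move=> ->; apply: rpred0.
case=> r vs; rewrite -[v](subrK (r *: e)); apply: rpredD.
  by apply: IHs vs => x xs; apply: sS; rewrite inE xs orbT.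
by apply: rpredZ; apply: sS; rewrite inE eqxx.
Qed.

Lemma in_span_cat s t v : in_span t v -> in_span (s ++ t) v.
Proof. by move=> tv; elim: s => //= e s IHs; apply: in_span_cons. Qed.

Lemma in_span_catW s t v : in_span s v -> in_span (s ++ t) v.
Proof.
elim: s v => [|e s IHs] v /=; first by move=> ->; apply: in_span0.
by case=> r /IHs vs; exists r.
Qed.

Lemma in_span_sum s n (c : 'I_n -> R) (w : 'I_n -> V) :
  (forall i, in_span s (w i)) -> in_span s (\sum_i c i *: w i).
Proof.
move=> sw; elim/big_ind: _ => [|x y sx sy|i _]; first exact: in_span0.
  by rewrite -[x]scale1r -[y]scale1r; apply: in_spanP.
by rewrite -[_ *: _]addr0 -[0](scale0r (w i)); apply: in_spanP.
Qed.

Hypothesis noethR : left_noetherian R.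

(** Induction on the generators: the coefficients of [e] occurring in elements
    of [S] form a left ideal, which is finitely generated, and elements of [S]
    realizing its generators reduce [S] to the submodule of its elements spanned
    by [s] alone. *)
Lemma noetherian_span s (S : submodClosed V) :
  (forall v, v \in S -> in_span s v) ->
  exists2 t, {subset t <= S} & forall v, v \in S -> in_span t v.
Proof.
elim: s S => [|e s IHs] S sS; first by exists [::].
pose I : {pred R^o} := [pred r : R | `[< exists2 v, v \in S & in_span s (v - r *: e) >]].
have Icl : subsemimod_closed I.
  split; [split|].
  - apply/asboolP; exists 0; first exact: rpred0.
    by rewrite scale0r subr0; apply: in_span0.
  - move=> a b /asboolP[u uS ua] /asboolP[v vS vb]; apply/asboolP.
    exists (u + v); first exact: rpredD.
    by have := in_spanP 1 1 ua vb; rewrite !scale1r scalerDl opprD addrACA.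
  - move=> c a /asboolP[u uS ua]; apply/asboolP.
    exists (c *: u); first exact: rpredZ.
    by have := in_spanP c 0 ua ua; rewrite scale0r addr0 scalerBr scalerA.
pose J : submodClosed R^o := HB.pack I (GRing.isSubmodClosed.Build _ _ I Icl).
have [n [r rP]] := noethR J.
have rI i : exists2 v, v \in S & in_span s (v - (val (r i) : R) *: e).
  by apply/asboolP; apply: (valP (r i)).
pose w i := s2val (cid2 (rI i)).
have wS i : w i \in S by rewrite /w; case: cid2.
have wr i : in_span s (w i - (val (r i) : R) *: e) by rewrite /w; case: cid2.
pose S' : {pred V} := [pred v : V | (v \in S) && `[< in_span s v >]].
have S'cl : subsemimod_closed S'.
  split; [split|].
  - by rewrite inE rpred0; apply/asboolP/in_span0.
  - move=> a b /andP[aS /asboolP sa] /andP[bS /asboolP sb].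
    rewrite inE rpredD //; apply/asboolP.
    by rewrite -[a]scale1r -[b]scale1r; apply: in_spanP.
  - move=> c a /andP[aS /asboolP sa]; rewrite inE rpredZ //; apply/asboolP.
    by rewrite -[_ *: _]addr0 -[0](scale0r a); apply: in_spanP.
pose S'' : submodClosed V := HB.pack S' (GRing.isSubmodClosed.Build _ _ S' S'cl).
have [|t tS' tP] := IHs S''; first by move=> v /andP[_ /asboolP].
exists (t ++ [seq w i | i : 'I_n]) => [x|v vS].
  by rewrite mem_cat => /orP[/tS'/andP[]//|/mapP[i _ ->]].
have [a av] := sS v vS.
have aI : a \in I by apply/asboolP; exists v.
have [c cE] := rP (Sub a aI).
have {}cE : a = \sum_i c i * val (r i).
  by rewrite -[LHS]/(val (Sub a aI : submod J)) cE linear_sum.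
pose u := \sum_i c i *: w i.
have su : in_span (t ++ [seq w i | i : 'I_n]) u.
  by apply: in_span_sum => i; apply/in_span_cat/in_span_mem/map_f; rewrite mem_enum.
rewrite -[v](subrK u) -[v - u]scale1r -[u in _ + u]scale1r; apply: in_spanP => //.
apply/in_span_catW/tP/andP; split.
  by rewrite -scaleN1r rpredD // rpredZ // rpred_sum // => i _; apply: rpredZ.
apply/asboolP.
have -> : v - u = 1 *: (v - a *: e) + (-1) *: \sum_i c i *: (w i - (val (r i) : R) *: e).
  rewrite scale1r scaleN1r.
  have -> : \sum_i c i *: (w i - (val (r i) : R) *: e) = u - a *: e.
    rewrite cE scaler_suml -sumrB; apply: eq_bigr => i _.
    by rewrite scalerBr scalerA.
  by rewrite opprB addrA subrK.
by apply: in_spanP => //; apply: in_span_sum.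
Qed.

(** The union of the kernels of the powers of [p] is finitely generated, so it
    is the kernel of a single power [p^m]. If [p x = 0] and [x = p^m u], then
    [u] is in this union, whence [x = 0]. *)
Lemma noetherian_hopfian (p : {linear V -> V}) :
  fin_gen V -> (forall v, exists u, p u = v) -> injective p.
Proof.
move=> [n [e eP]] p_surj.
pose K : {pred V} := [pred v : V | `[< exists m, iter m p v = 0 >]].
have iter_p m : linear (iter m p).
  by elim: m => [|m IHm] a u v //; rewrite !iterS IHm linearP.
have iter0 m : iter m p 0 = 0 by elim: m => //= m ->; apply: linear0.
have iter_add m k v : iter m p v = 0 -> iter (k + m) p v = 0.
  by move=> mv; rewrite iterD mv iter0.
have Kcl : subsemimod_closed K.
  split; [split|].
  - by apply/asboolP; exists 0%N.
  - move=> u v /asboolP[a ua] /asboolP[b vb]; apply/asboolP; exists (a + b)%N.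
    rewrite -[u]scale1r iter_p scale1r [iter _ p v]iter_add // addr0.
    by rewrite addnC; apply: iter_add.
  - move=> c u /asboolP[a ua]; apply/asboolP; exists a.
    by rewrite -[_ *: _]addr0 iter_p ua iter0 scaler0 addr0.
pose S : submodClosed V := HB.pack K (GRing.isSubmodClosed.Build _ _ K Kcl).
have [v vS|t tS tP] := @noetherian_span [seq e i | i : 'I_n] S.
  have [c ->] := eP v; apply: in_span_sum => i.
  by apply/in_span_mem/map_f; rewrite mem_enum.
have [m mP] : exists m, forall v, v \in t -> iter m p v = 0.
  elim: t tS {tP} => [|a t IHt] tS; first by exists 0%N.
  have [|m mP] := IHt; first by move=> x xt; apply: tS; rewrite inE xt orbT.
  have /asboolP[k kP] : a \in K by apply: tS; rewrite inE eqxx.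
  exists (m + k)%N => v; rewrite inE => /orP[/eqP->|/mP vm]; first exact: iter_add.
  by rewrite addnC; apply: iter_add.
pose Km : {pred V} := [pred v : V | iter m p v == 0].
have Kmcl : subsemimod_closed Km.
  split; [split|].
  - by rewrite inE iter0.
  - move=> u v /eqP um /eqP vm; apply/eqP.
    by rewrite -[u]scale1r iter_p um vm scaler0 addr0.
  - move=> c u /eqP um; apply/eqP.
    by rewrite -[_ *: _]addr0 iter_p um iter0 scaler0 addr0.
pose T : submodClosed V := HB.pack Km (GRing.isSubmodClosed.Build _ _ Km Kmcl).
have iter_surj k v : exists u, iter k p u = v.
  elim: k v => [|k IHk] v; first by exists v.
  have [u <-] := p_surj v; have [w <-] := IHk u; by exists w.
move=> x y pxy; apply/eqP; rewrite -subr_eq0; apply/eqP.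
have [u uE] := iter_surj m (x - y); rewrite -uE; apply/eqP.
apply: (@in_span_sub t T) => [v /mP/eqP//|]; apply: tP; apply/asboolP.
by exists m.+1; rewrite iterS uE linearB pxy subrr.
Qed.
End Hopfian.

(** An abstract isomorphism [T' -> T] suffices to make a canonical surjection
    [K -> T] injective, once a surjection [T' -> K] exists: composing them gives
    a surjective endomorphism of [K]. *)
Lemma hopfian_inj (R : pzRingType) (K T T' : lmodType R)
    (f : {linear K -> T}) (r : {linear T' -> K}) :
  left_noetherian R -> fin_gen K -> lmod_iso T' T ->
  (forall t, exists k, f k = t) -> (forall k, exists t, r t = k) ->
  injective f.
Proof.
move=> nR fgK [i [j ij ji]] f_surj r_surj.
have jl : linear j.
  by move=> a x y; apply: (can_inj ij); rewrite linearP !ji.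
have el : linear (fun k => r (j (f k))).
  by move=> a x y; rewrite linearP jl linearP.
suff inj_e : injective (lin_of el).
  by move=> x y e; apply: inj_e; rewrite !lin_ofE e.
apply: noetherian_hopfian => // k; have [t <-] := r_surj k.
by have [u uE] := f_surj (i t); exists u; rewrite lin_ofE uE ij.
Qed.

(** * Tensor products, exactness and cocycles *)

Lemma fin_gen_image (R : pzRingType) (V W : lmodType R) (p : {linear V -> W}) :
  (forall w, exists v, p v = w) -> fin_gen V -> fin_gen W.
Proof.
move=> p_surj [n [e eP]]; exists n, (fun i => p (e i)) => w.
have [v <-] := p_surj w; have [c ->] := eP v; exists c.
by rewrite linear_sum; apply: eq_bigr => i _; rewrite linearZ.
Qed.

(** Exactness at [P 0] makes [d^(-1)] a surjection onto the cocycles. *)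
Lemma kernel_map_cover (R : pzRingType) (P : complex R) (L : lmodType R)
    (b : {linear L -> P 0}) : exact_cx P -> kernel_map b ->
  exists s : {linear P (Negz 0) -> L},
    (forall x, b (s x) = cdiff P (Negz 0) x) /\ (forall l, exists x, s x = l).
Proof.
move=> exP [b_inj bE].
have [s sE] : exists s : {linear P (Negz 0) -> L},
    forall x, b (s x) = cdiff P (Negz 0) x.
  pose s x := projT1 (cid ((bE _).1 (@cdiffK _ P (Negz 0) x))).
  have sE x : b (s x) = cdiff P (Negz 0) x by rewrite /s; case: cid.
  have sl : linear s by move=> a x y; apply: b_inj; rewrite !(linearP, sE).
  by exists (lin_of sl) => x; rewrite lin_ofE sE.
have s_surj l : exists x, s x = l.
  have [|x xl] := @exP (Negz 0) (b l); first by apply/bE; exists l.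
  by exists x; apply: b_inj; rewrite sE.
by exists s.
Qed.

Section TMapL.
Variables (R S : pzRingType) (U : bimodType R S).

Fact tmap_scale (V W : lmodType S) (d : {linear V -> W}) (r : R) (u : U) v :
  tens (r *: u : U) (d v) = r *: tens u (d v).
Proof. by rewrite scale_tens. Qed.

Definition tmapL (V W : lmodType S) (d : {linear V -> W}) :
  {linear tensor U V -> tensor U W} := tliftL (tmap_bal U d) (tmap_scale d).

Lemma tmapL_tens (V W : lmodType S) (d : {linear V -> W}) (u : U) v :
  tmapL d (tens u v) = tens u (d v).
Proof. exact: tliftL_tens. Qed.

Lemma tmapL_comp (V1 V2 V3 : lmodType S) (f : {linear V1 -> V2})
    (g : {linear V2 -> V3}) (h : {linear V1 -> V3}) :
  (forall v, g (f v) = h v) -> forall x, tmapL g (tmapL f x) = tmapL h x.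
Proof.
move=> gf x; elim/tensor_ind: x => [|x y ex ey|u v]; first by rewrite !linear0.
  by rewrite !linearD ex ey.
by rewrite !tmapL_tens gf.
Qed.

Lemma tmapL_comp0 (V1 V2 V3 : lmodType S) (f : {linear V1 -> V2})
    (g : {linear V2 -> V3}) :
  (forall v, g (f v) = 0) -> forall x, tmapL g (tmapL f x) = 0.
Proof.
move=> gf x; elim/tensor_ind: x => [|x y ex ey|u v]; first by rewrite !linear0.
  by rewrite !linearD ex ey addr0.
by rewrite !tmapL_tens gf tens0r.
Qed.

Lemma tmapL_sum (V1 V2 : lmodType S) n (f : 'I_n -> {linear V1 -> V2})
    (h : {linear V1 -> V2}) :
  (forall v, h v = \sum_i f i v) -> forall x, tmapL h x = \sum_i tmapL (f i) x.
Proof.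
move=> hf x; elim/tensor_ind: x => [|x y ex ey|u v].
- by rewrite linear0 big1 // => i _; rewrite linear0.
- rewrite linearD ex ey -big_split; apply: eq_bigr => i _.
  by rewrite linearD.
- rewrite tmapL_tens hf; under [RHS]eq_bigr do rewrite tmapL_tens.
  by elim/big_ind2: _ => [|a b c d <- <-|//]; rewrite ?tens0r ?tensDr.
Qed.

Lemma tmapL_id (V : lmodType S) (h : {linear V -> V}) :
  (forall v, h v = v) -> forall x, tmapL h x = x.
Proof.
move=> hE x; elim/tensor_ind: x => [|x y ex ey|u v]; first by rewrite linear0.
  by rewrite linearD ex ey.
by rewrite tmapL_tens hE.
Qed.

Lemma tmapL_surj (V W : lmodType S) (d : {linear V -> W}) :
  (forall w, exists v, d v = w) -> forall y, exists x, tmapL d x = y.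
Proof.
move=> d_surj; elim/tensor_ind => [|_ _ [x <-] [y <-]|u w].
- by exists 0; rewrite linear0.
- by exists (x + y); rewrite linearD.
- by have [v <-] := d_surj w; exists (tens u v); rewrite tmapL_tens.
Qed.

Lemma fin_gen_tensor (V : lmodType S) :
  fin_gen U -> fin_gen V -> fin_gen (tensor U V).
Proof.
move=> [m [e eP]] [n [e' e'P]].
pose b (k : 'I_#|{: 'I_m * 'I_n}|) := tens (e (enum_val k).1) (e' (enum_val k).2).
exists #|{: 'I_m * 'I_n}|, b.
elim/tensor_ind => [|x y [c cE] [d dE]|u v].
- by exists (fun=> 0); rewrite big1 // => i _; rewrite scale0r.
- exists (fun k => c k + d k); rewrite cE dE -big_split.
  by apply: eq_bigr => k _; rewrite scalerDl.
have [c ->] := e'P v.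
have cP j : exists f : 'I_m -> R, rscale u (c j) = \sum_i f i *: e i by apply: eP.
pose f j := projT1 (cid (cP j)).
have fE j : rscale u (c j) = \sum_i f j i *: e i by rewrite /f; case: cid.
exists (fun k => f (enum_val k).2 (enum_val k).1).
rewrite -(big_enum_val (fun p : 'I_m * 'I_n => f p.2 p.1 *: tens (e p.1) (e' p.2))) /=.
rewrite -(pair_big xpredT xpredT (fun i j => f j i *: tens (e i) (e' j))) /=.
rewrite exchange_big /= (big_morph (tens u) (@tensDr _ _ _ u) (@tens0r _ _ _ u)).
apply: eq_bigr => j _; rewrite -tens_bal fE.
rewrite (big_morph (fun x : U => tens x (e' j))
  (fun x y => @tensDl _ _ _ x y _) (@tens0l _ _ _ _)).
by apply: eq_bigr => i _; rewrite scale_tens.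
Qed.

Definition tensor_cx (P : complex S) : complex R :=
  @Complex R (fun i => tensor U (P i)) (fun i => tmapL (cdiff P i))
    (fun i => tmapL_comp0 (@cdiffK _ P i)).

(** Cocycles commute with the tensor product when both complexes are exact: [L]
    is the cokernel of [d^(-2)], and [U (x) L] that of [U (x) d^(-2)]. *)
Lemma tensor_kernel_map (P : complex S) (L : lmodType S)
    (b : {linear L -> P 0}) :
  exact_cx P -> exact_cx (tensor_cx P) -> kernel_map b ->
  kernel_map (tmapL b : {linear tensor U L -> tensor_cx P 0}).
Proof.
move=> exP exUP [b_inj bE].
have [s [sE s_surj]] := kernel_map_cover exP (conj b_inj bE).
have bsE x : tmapL b (tmapL s x) = cdiff (tensor_cx P) (Negz 0) x.
  exact: tmapL_comp sE x.
split=> [|y].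
  apply: linear_inj0 => x; have [z <-] := tmapL_surj s_surj x.
  have s_d t : tmapL s (tmapL (cdiff P (Negz 1)) t) = 0.
    apply: tmapL_comp0 t => v; apply: b_inj; rewrite linear0.
    by apply: etrans (sE _) _; apply: (@cdiffK _ P (Negz 1)).
  by rewrite bsE => /(@exUP (Negz 1))[t <-]; apply: s_d.
split=> [dy|[x <-]].
  by have [x <-] := @exUP (Negz 0) y dy; exists (tmapL s x); rewrite bsE.
have [z <-] := tmapL_surj s_surj x; rewrite bsE.
exact: (@cdiffK _ (tensor_cx P) (Negz 0)).
Qed.

(** [U (x) Q] is a direct summand of a power of [U], through the maps
    [u |-> u (x) e_i] and [u (x) q |-> u c_i(q)] of a dual basis of [Q]. *)
Lemma tensor_dual_basis (Q : lmodType S) : fin_gen Q -> projective Q ->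
  exists n (inj : 'I_n -> {linear U -> tensor U Q})
    (pr : 'I_n -> {linear tensor U Q -> U}),
  forall x, x = \sum_i inj i (pr i x).
Proof.
move=> fgQ prQ; have [n [e [c cE]]] := dual_basis fgQ prQ.
have il i : linear (fun u : U => tens u (e i)).
  by move=> a u v; rewrite tensDl scale_tens.
have bal i : balanced (fun (u : U) (q : Q) => rscale u (c i q : S)).
  split=> [u u' v|u v v'|u a v]; first exact: rscaleDl.
    by rewrite linearD rscaleDr.
  by rewrite linearZ rscaleA.
have sc i r (u : U) q : rscale (r *: u : U) (c i q : S) = r *: rscale u (c i q : S).
  by rewrite scale_rscale.
exists n, (fun i => lin_of (il i)), (fun i => tliftL (bal i) (sc i)) => x.
elim/tensor_ind: x => [|x y ex ey|u q].
- by rewrite big1 // => i _; rewrite !linear0.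
- rewrite {1}ex {1}ey -big_split; apply: eq_bigr => i _.
  by rewrite !linearD.
- rewrite {1}[q]cE (big_morph (tens u) (@tensDr _ _ _ u) (@tens0r _ _ _ u)).
  by apply: eq_bigr => i _; rewrite tliftL_tens lin_ofE tens_bal.
Qed.
End TMapL.

Section HomExact.
Variables (R : pzRingType) (P : complex R).

Lemma hom_exact_sum (U W : lmodType R) n (inj : 'I_n -> {linear U -> W})
    (pr : 'I_n -> {linear W -> U}) :
  (forall w, w = \sum_i inj i (pr i w)) -> hom_exact P U -> hom_exact P W.
Proof.
move=> wE homU i h hd.
have kP j : exists k : {linear P (1 + (1 + i)) -> U},
    forall y, k (cdiff P (1 + i) y) = pr j (h y).
  have hl : linear (fun y => pr j (h y)) by move=> a x y; rewrite !linearP.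
  by apply: (homU i (lin_of hl)) => x; rewrite lin_ofE hd linear0.
pose k j := projT1 (cid (kP j)).
have kE j y : k j (cdiff P (1 + i) y) = pr j (h y) by rewrite /k; case: cid.
have kl : linear (fun y => \sum_j inj j (k j y)).
  move=> a x y; rewrite scaler_sumr -big_split; apply: eq_bigr => j _.
  by rewrite !linearP.
exists (lin_of kl) => y; rewrite lin_ofE [RHS]wE.
by apply: eq_bigr => j _; rewrite kE.
Qed.

Lemma hom_exact_split (U V W : lmodType R)
    (i1 : {linear U -> W}) (p1 : {linear W -> U})
    (i2 : {linear V -> W}) (p2 : {linear W -> V}) :
  (forall w, w = i1 (p1 w) + i2 (p2 w)) -> hom_exact P U -> hom_exact P V ->
  hom_exact P W.
Proof.
move=> wE homU homV i h hd.
have hl1 : linear (fun y => p1 (h y)) by move=> a x y; rewrite !linearP.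
have hl2 : linear (fun y => p2 (h y)) by move=> a x y; rewrite !linearP.
have [x|k1 k1E] := homU i (lin_of hl1); first by rewrite lin_ofE hd linear0.
have [x|k2 k2E] := homV i (lin_of hl2); first by rewrite lin_ofE hd linear0.
have kl : linear (fun y => i1 (k1 y) + i2 (k2 y)).
  by move=> a x y; rewrite !linearP scalerDr addrACA.
by exists (lin_of kl) => y; rewrite lin_ofE k1E k2E -wE.
Qed.

Lemma hom_exact_tensor (S : pzRingType) (U : bimodType R S) (Q : lmodType S) :
  fin_gen Q -> projective Q -> hom_exact P U -> hom_exact P (tensor U Q).
Proof.
move=> fgQ prQ; have [n [inj [pr wE]]] := tensor_dual_basis U fgQ prQ.
exact: hom_exact_sum wE.
Qed.

(** [U (x) (V (x) Q)] is a summand of a power of [U (x) V]. *)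
Lemma hom_exact_tensor2 (S T : pzRingType) (U : bimodType R S)
    (V : bimodType S T) (Q : lmodType T) :
  fin_gen Q -> projective Q -> hom_exact P (tensor U V) ->
  hom_exact P (tensor U (tensor V Q)).
Proof.
move=> fgQ prQ; have [n [inj [pr wE]]] := tensor_dual_basis V fgQ prQ.
apply: (@hom_exact_sum _ _ n (fun i => tmapL U (inj i)) (fun i => tmapL U (pr i))).
have cl i : linear (fun w => inj i (pr i w)) by move=> a x y; rewrite !linearP.
move=> w; have -> : \sum_i tmapL U (inj i) (tmapL U (pr i) w)
    = \sum_i tmapL U (lin_of (cl i)) w.
  by apply: eq_bigr => i _; apply: tmapL_comp.
have idl : linear (@id (tensor V Q)) by [].
rewrite -(@tmapL_sum _ _ U _ _ n _ (lin_of idl)) => [|v]; last exact: wE.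
by rewrite tmapL_id.
Qed.
End HomExact.

Section TensorAssoc.
Variables (R S T : pzRingType) (U : bimodType R S) (V : bimodType S T).
Variable W : lmodType T.

Lemma tensor_assoc : exists (f : {linear tensor (tensor U V) W -> tensor U (tensor V W)})
    (g : {linear tensor U (tensor V W) -> tensor (tensor U V) W}),
  [/\ cancel f g, cancel g f,
   forall (u : U) (v : V) w, f (tens (tens u v) w) = tens u (tens v w)
   & forall (u : U) (v : V) w, g (tens u (tens v w)) = tens (tens u v) w].
Proof.
have tl (w : W) : linear (fun v : V => tens v w).
  by move=> a x y; rewrite tensDl scale_tens.
have f_bal : balanced (fun (x : tensor U V) w => tmapL U (lin_of (tl w)) x).
  split=> [x x' w|x w w'|x a w]; first by rewrite linearD.
    elim/tensor_ind: x => [|x y ex ey|u v]; first by rewrite !linear0 addr0.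
      by rewrite !linearD ex ey addrACA.
    by rewrite !tmapL_tens !lin_ofE tensDr tensDr.
  elim/tensor_ind: x => [|x y ex ey|u v]; first by rewrite rscale0l !linear0.
    by rewrite rscaleDl !linearD ex ey.
  by rewrite rscale_tens !tmapL_tens !lin_ofE tens_bal.
have f_sc r (x : tensor U V) w :
    tmapL U (lin_of (tl w)) (r *: x) = r *: tmapL U (lin_of (tl w)) x.
  by rewrite linearZ.
have g_bal0 (u : U) : balanced (fun (v : V) (w : W) => tens (tens u v : tensor U V) w).
  split=> [v v' w|v w w'|v a w]; first by rewrite tensDr tensDl.
    by rewrite tensDr.
  by rewrite -tens_bal rscale_tens.
pose gu (u : U) := tlift (fun (v : V) (w : W) => tens (tens u v : tensor U V) w).
have guD u : {morph gu u : x y / x + y} by apply: tliftD.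
have gu0 u : gu u 0 = 0 by apply: tlift0.
have guE u v w : gu u (tens v w) = tens (tens u v) w by apply: tlift_tens.
have g_bal : balanced (fun (u : U) (x : tensor V W) => gu u x).
  split=> [u u' x|u x y|u a x]; last 2 first.
  - exact: guD.
  - elim/tensor_ind: x => [|x y ex ey|v w]; first by rewrite scaler0 !gu0.
      by rewrite scalerDr !guD ex ey.
    by rewrite scale_tens !guE tens_bal.
  elim/tensor_ind: x => [|x y ex ey|v w]; first by rewrite !gu0 addr0.
    by rewrite !guD ex ey addrACA.
  by rewrite !guE !tensDl.
have g_sc r (u : U) (x : tensor V W) : gu (r *: u) x = r *: gu u x.
  elim/tensor_ind: x => [|x y ex ey|v w]; first by rewrite !gu0 scaler0.
    by rewrite !guD ex ey scalerDr.
  by rewrite !guE scale_tens scale_tens.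
pose f := tliftL f_bal f_sc; pose g := tliftL g_bal g_sc.
have fE (u : U) (v : V) w : f (tens (tens u v) w) = tens u (tens v w).
  by rewrite /f tliftL_tens tmapL_tens.
have gE (u : U) (v : V) w : g (tens u (tens v w)) = tens (tens u v) w.
  by rewrite /g tliftL_tens guE.
exists f, g; split=> //.
- elim/tensor_ind => [|x y ex ey|x w]; first by rewrite !linear0.
    by rewrite !linearD ex ey.
  elim/tensor_ind: x => [|x y ex ey|u v]; first by rewrite tens0l !linear0.
    by rewrite tensDl !linearD ex ey.
  by rewrite fE gE.
- elim/tensor_ind => [|x y ex ey|u x]; first by rewrite !linear0.
    by rewrite !linearD ex ey.
  elim/tensor_ind: x => [|x y ex ey|v w]; first by rewrite tens0r !linear0.
    by rewrite tensDr !linearD ex ey.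
  by rewrite gE fE.
Qed.
End TensorAssoc.

Lemma tensor_cx_assoc (R S T : pzRingType) (U : bimodType R S)
    (V : bimodType S T) (Q : complex T) :
  exact_cx (tensor_cx (tensor U V) Q) -> exact_cx (tensor_cx U (tensor_cx V Q)).
Proof.
move=> exQ i y dy.
have [f1 [g1 [fg1 gf1 f1E g1E]]] := tensor_assoc U V (Q (1 + i)).
have [f2 [g2 [fg2 gf2 f2E g2E]]] := tensor_assoc U V (Q (1 + (1 + i))).
have [f0 [g0 [fg0 gf0 f0E g0E]]] := tensor_assoc U V (Q i).
have n1 z : tmapL _ (cdiff Q (1 + i)) (g1 z) = g2 (tmapL _ (tmapL _ (cdiff Q (1 + i))) z).
  elim/tensor_ind: z => [|x x' ex ex'|u x]; first by rewrite !linear0.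
    by rewrite !linearD ex ex'.
  elim/tensor_ind: x => [|x x' ex ex'|v w]; first by rewrite tens0r !linear0.
    by rewrite tensDr !linearD ex ex'.
  by rewrite g1E !tmapL_tens g2E.
have n0 z : tmapL _ (tmapL _ (cdiff Q i)) (f0 z) = f1 (tmapL _ (cdiff Q i) z).
  elim/tensor_ind: z => [|x x' ex ex'|x w]; first by rewrite !linear0.
    by rewrite !linearD ex ex'.
  elim/tensor_ind: x => [|x x' ex ex'|u v]; first by rewrite tens0l !linear0.
    by rewrite tensDl !linearD ex ex'.
  by rewrite f0E !tmapL_tens f1E.
have [|z zE] := exQ i (g1 y).
  by rewrite [LHS]n1 [X in g2 X]dy linear0.
by exists (f0 z); rewrite [LHS]n0 [X in f1 X]zE gf1.
Qed.

(** The part of the long exact sequence of a short exact sequence of complexes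
    [B -> W -> A] that gives exactness of [W]; it is stated in one degree, to
    serve for complexes and for their tensor products alike. *)
Lemma exact_middle (R : pzRingType) (A0 A1 A2 B0 B1 B2 W0 W1 W2 : lmodType R)
    (dA0 : {linear A0 -> A1}) (dA1 : {linear A1 -> A2})
    (dB0 : {linear B0 -> B1}) (dB1 : {linear B1 -> B2})
    (dW0 : {linear W0 -> W1}) (dW1 : {linear W1 -> W2})
    (j0 : {linear B0 -> W0}) (j1 : {linear B1 -> W1}) (j2 : {linear B2 -> W2})
    (q0 : {linear W0 -> A0}) (q1 : {linear W1 -> A1}) (q2 : {linear W2 -> A2}) :
  (forall w, dW1 (dW0 w) = 0) ->
  (forall b, dW0 (j0 b) = j1 (dB0 b)) -> (forall b, dW1 (j1 b) = j2 (dB1 b)) ->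
  (forall w, q1 (dW0 w) = dA0 (q0 w)) -> (forall w, q2 (dW1 w) = dA1 (q1 w)) ->
  (forall a, exists w, q0 w = a) -> (forall w, q1 w = 0 -> exists b, j1 b = w) ->
  injective j2 ->
  (forall a, dA1 a = 0 -> exists a', dA0 a' = a) ->
  (forall b, dB1 b = 0 -> exists b', dB0 b' = b) ->
  forall w, dW1 w = 0 -> exists w', dW0 w' = w.
Proof.
move=> dd j01 j12 q01 q12 q_surj q_ker j_inj exA exB w dw.
have [|a aE] := exA (q1 w); first by rewrite -q12 dw linear0.
have [w0 w0E] := q_surj a.
have [|b bE] := q_ker (w - dW0 w0); first by rewrite linearB q01 w0E aE subrr.
have [|b0 b0E] := exB b.
  by apply: j_inj; rewrite -j12 bE linearB dw dd subrr linear0.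
by exists (w0 + j0 b0); rewrite linearD j01 b0E bE addrC subrK.
Qed.

Section TwistedExact.
Variables (R : pzRingType) (P E : complex R).
Variables (t : forall i, {linear P i -> E (1 + i)}) (tP : twisting t).

Fact fstL_linear (U V : lmodType R) : linear (@fst U V). Proof. by []. Qed.
Fact sndL_linear (U V : lmodType R) : linear (@snd U V). Proof. by []. Qed.
Fact inlL_linear (U V : lmodType R) : linear (fun u : U => (u, 0) : U * V).
Proof. by move=> a x y; congr (_, _); rewrite /= scaler0 addr0. Qed.
Fact inrL_linear (U V : lmodType R) : linear (fun v : V => (0, v) : U * V).
Proof. by move=> a x y; congr (_, _); rewrite /= scaler0 addr0. Qed.
Definition fstL (U V : lmodType R) := lin_of (@fstL_linear U V).
Definition sndL (U V : lmodType R) := lin_of (@sndL_linear U V).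
Definition inlL (U V : lmodType R) := lin_of (@inlL_linear U V).
Definition inrL (U V : lmodType R) := lin_of (@inrL_linear U V).

Lemma inlrL (U V : lmodType R) (z : U * V) :
  z = inlL U V (fstL U V z) + inrL U V (sndL U V z).
Proof. by case: z => x y; congr (_, _); rewrite /= ?addr0 ?add0r. Qed.

Lemma twisted_exact : exact_cx P -> exact_cx E -> exact_cx (twisted tP).
Proof.
move=> exP exE i; pose I k := inrL (P k) (E k); pose F k := fstL (P k) (E k).
apply: (exact_middle (j0 := I i) (j1 := I (1 + i)) (j2 := I (1 + (1 + i)))
  (q0 := F i) (q1 := F (1 + i)) (q2 := F (1 + (1 + i)))
  (dA0 := cdiff P i) (dA1 := cdiff P (1 + i))
  (dB0 := cdiff E i) (dB1 := cdiff E (1 + i))) => //.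
- exact: (@cdiffK _ (twisted tP)).
- by move=> b; congr (_, _) => /=; rewrite linear0 ?add0r.
- by move=> b; congr (_, _) => /=; rewrite linear0 ?add0r.
- by move=> a; exists (a, 0).
- by move=> [x e] xE; exists e; apply: (congr1 (fun u => (u, e)) (esym xE)).
- by move=> x y [].
- exact: exP.
- exact: exE.
Qed.

(** The extension of [P] by [E] splits in each degree, so it stays exact under
    the tensor product. *)
Lemma tensor_twisted_exact (S : pzRingType) (U : bimodType S R) :
  exact_cx (tensor_cx U P) -> exact_cx (tensor_cx U E) ->
  exact_cx (tensor_cx U (twisted tP)).
Proof.
move=> exP exE i; pose I k := inrL (P k) (E k); pose F k := fstL (P k) (E k).
pose K k := inlL (P k) (E k); pose L k := sndL (P k) (E k).
have sq (V1 V2 V3 V4 : lmodType R) (f : {linear V1 -> V2}) (g : {linear V2 -> V4})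
    (f' : {linear V1 -> V3}) (g' : {linear V3 -> V4}) :
    (forall v, g (f v) = g' (f' v)) ->
    forall x, tmapL U g (tmapL U f x) = tmapL U g' (tmapL U f' x).
  move=> e x; have hl : linear (fun v => g (f v)) by move=> a y z; rewrite !linearP.
  rewrite (tmapL_comp (h := lin_of hl)) // (tmapL_comp (h := lin_of hl)) // => v.
  by rewrite -e.
have idl (V : lmodType R) : linear (@id V) by [].
apply: (exact_middle (j0 := tmapL U (I i)) (j1 := tmapL U (I (1 + i)))
  (j2 := tmapL U (I (1 + (1 + i)))) (q0 := tmapL U (F i))
  (q1 := tmapL U (F (1 + i))) (q2 := tmapL U (F (1 + (1 + i))))
  (dA0 := cdiff (tensor_cx U P) i) (dA1 := cdiff (tensor_cx U P) (1 + i))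
  (dB0 := cdiff (tensor_cx U E) i) (dB1 := cdiff (tensor_cx U E) (1 + i))) => //.
- exact: (@cdiffK _ (tensor_cx U (twisted tP))).
- by apply: sq => b; congr (_, _) => /=; rewrite linear0 ?add0r.
- by apply: sq => b; congr (_, _) => /=; rewrite linear0 ?add0r.
- exact: sq.
- exact: sq.
- by move=> a; exists (tmapL U (K i) a);
  rewrite (tmapL_comp (h := lin_of (idl _))) // tmapL_id.
- move=> w wE; exists (tmapL U (L (1 + i)) w).
  have wD : w = tmapL U (K (1 + i)) (tmapL U (F (1 + i)) w)
              + tmapL U (I (1 + i)) (tmapL U (L (1 + i)) w).
    elim/tensor_ind: w {wE} => [|x y ex ey|u v]; first by rewrite !linear0 addr0.
      by rewrite {1}ex {1}ey !linearD addrACA.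
    by rewrite !tmapL_tens -tensDr -inlrL.
  by rewrite [RHS]wD wE linear0 add0r.
- apply: (@can_inj _ _ _ (tmapL U (L (1 + (1 + i))))) => x.
  by rewrite (tmapL_comp (h := lin_of (idl _))) // tmapL_id.
- exact: exP.
- exact: exE.
Qed.
End TwistedExact.

(** * The induced modules over the Morita context ring *)

Section Blocks.
Variables (A G : pzRingType) (M : bimodType G A) (N : bimodType A G).
Local Notation J := (tensor M N).
Local Notation B := (trivext G J).
Local Notation C := (nctensor M N).

Definition blockA (a : A) : C := ((a, 0), (0, 0)).
Definition blockN (n : N) : C := ((0, n), (0, 0)).
Definition blockM (m : M) : C := ((0, 0), (m, 0)).
Definition blockB (b : B) : C := ((0, 0), (0, b)).

Lemma nct_mulE a n m b a' n' m' b' :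
  (((a, n), (m, b)) : C) * (((a', n'), (m', b')) : C)
  = ((a * a', a *: n' + rscale n (te_proj b')),
     (rscale m a' + te_proj b *: m', te_ideal (tens m n' : J) + b * b')).
Proof. by []. Qed.

Lemma blockE a n m b :
  ((a, n), (m, b)) = blockA a + blockN n + blockM m + blockB b.
Proof. by congr ((_, _), (_, _)); rewrite /= ?addr0 ?add0r. Qed.

Lemma blockAD : {morph blockA : x y / x + y}.
Proof. by move=> x y; congr ((_, _), (_, _)); rewrite /= addr0. Qed.
Lemma blockND : {morph blockN : x y / x + y}.
Proof. by move=> x y; congr ((_, _), (_, _)); rewrite /= addr0. Qed.
Lemma blockMD : {morph blockM : x y / x + y}.
Proof. by move=> x y; congr ((_, _), (_, _)); rewrite /= addr0. Qed.
Lemma blockBD : {morph blockB : x y / x + y}.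
Proof. by move=> x y; congr ((_, _), (_, _)); rewrite /= addr0. Qed.

Lemma te_proj0 : te_proj (0 : B) = 0. Proof. by []. Qed.

Definition simpC := (nct_mulE, te_proj0, scale0r, scaler0, @rscale0l, @rscale0r,
  mulr0, mul0r, addr0, add0r, @tens0l, @tens0r, te_ideal0).

Lemma blockAA a a' : blockA a * blockA a' = blockA (a * a').
Proof. by rewrite !simpC. Qed.
Lemma blockAN a n : blockA a * blockN n = blockN (a *: n).
Proof. by rewrite !simpC. Qed.
Lemma blockAM a m : blockA a * blockM m = 0.
Proof. by rewrite !simpC. Qed.
Lemma blockAB a b : blockA a * blockB b = 0.
Proof. by rewrite !simpC. Qed.
Lemma blockNA n a : blockN n * blockA a = 0.
Proof. by rewrite !simpC. Qed.
Lemma blockNN n n' : blockN n * blockN n' = 0.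
Proof. by rewrite !simpC. Qed.
Lemma blockNM n m : blockN n * blockM m = 0.
Proof. by rewrite !simpC. Qed.
Lemma blockNB n b : blockN n * blockB b = blockN (rscale n (te_proj b)).
Proof. by rewrite !simpC. Qed.
Lemma blockMA m a : blockM m * blockA a = blockM (rscale m a).
Proof. by rewrite !simpC. Qed.
Lemma blockMN m n : blockM m * blockN n = blockB (te_ideal (tens m n)).
Proof. by rewrite !simpC. Qed.
Lemma blockMM m m' : blockM m * blockM m' = 0.
Proof. by rewrite !simpC. Qed.
Lemma blockMB m b : blockM m * blockB b = 0.
Proof. by rewrite !simpC. Qed.
Lemma blockBA b a : blockB b * blockA a = 0.
Proof. by rewrite !simpC. Qed.
Lemma blockBN b n : blockB b * blockN n = 0.
Proof. by rewrite !simpC. Qed.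
Lemma blockBM b m : blockB b * blockM m = blockM (te_proj b *: m).
Proof. by rewrite !simpC. Qed.
Lemma blockBB b b' : blockB b * blockB b' = blockB (b * b').
Proof. by rewrite !simpC. Qed.
Definition blockMul := (blockAA, blockAN, blockAM, blockAB, blockNA, blockNN,
  blockNM, blockNB, blockMA, blockMN, blockMM, blockMB, blockBA, blockBN,
  blockBM, blockBB).

Section Induced.
Variables (P : lmodType A) (Q : lmodType G).
Local Notation PQ := (P * tensor N Q)%type.

(** The [C]-module induced from the pair [(P, Q)], that is the direct sum of
    [C e_A (x) P] and [C e_B (x) Q], where [e_A] and [e_B] are the diagonal
    idempotents: its upper row is [X = P + N (x) Q] and its lower row is
    [Q + M (x) X]. Indeed [C e_A] has the entries [A] and [M], [C e_B] has the
    entries [N] and [G + M (x) N], and [M (x) X] collects [M (x) P] and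
    [(M (x) N) (x) Q]. *)
Definition induced : Type := (PQ * (Q * tensor M PQ))%type.
HB.instance Definition _ := GRing.Zmodule.copy induced (PQ * (Q * tensor M PQ))%type.

Fact ideal_act_linear q : linear (fun n : N => (0, tens n q) : PQ).
Proof.
by move=> a x y; congr (_, _); rewrite /= ?scaler0 ?addr0 // tensDl scale_tens.
Qed.
(** The action of [J = M (x) N] on the lower row: [m (x) n] first sends [q] up to
    [n (x) q] and then down again. *)
Definition ideal_act (q : Q) : {linear J -> tensor M PQ} :=
  tmapL M (lin_of (ideal_act_linear q)).

Lemma ideal_act_tens m n q : ideal_act q (tens m n) = tens m (0, tens n q).
Proof. exact: tmapL_tens. Qed.
Lemma pair0D (V W : zmodType) (x y : W) : (0, x + y) = (0, x) + (0, y) :> V * W.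
Proof. by congr (_, _); rewrite /= addr0. Qed.
Lemma ideal_actD q q' j : ideal_act (q + q') j = ideal_act q j + ideal_act q' j.
Proof.
elim/tensor_ind: j => [|x y ex ey|m n]; first by rewrite !linear0 addr0.
  by rewrite !linearD ex ey addrACA.
by rewrite !ideal_act_tens tensDr pair0D tensDr.
Qed.
Lemma ideal_act_rscale q j g : ideal_act q (rscale j g) = ideal_act (g *: q) j.
Proof.
elim/tensor_ind: j => [|x y ex ey|m n]; first by rewrite rscale0l !linear0.
  by rewrite rscaleDl !linearD ex ey.
by rewrite rscale_tens !ideal_act_tens tens_bal.
Qed.

Definition induced_scale (c : C) (z : induced) : induced :=
  let: ((a, n), (m, b)) := c in
  (a *: z.1 + (0, tens n z.2.1),
   (te_proj b *: z.2.1, tens m z.1 + te_proj b *: z.2.2 + ideal_act z.2.1 b.2)).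

Fact induced_scale_def a n m b (x : PQ) (q : Q) (s : tensor M PQ) :
  induced_scale ((a, n), (m, b)) (x, (q, s))
  = (a *: x + (0, tens n q),
     (te_proj b *: q, tens m x + te_proj b *: s + ideal_act q b.2)).
Proof. by []. Qed.
Fact te_coef (j : J) (b b' : B) :
  (te_ideal j + b * b').2 = j + (te_proj b *: b'.2 + rscale b.2 (te_proj b')).
Proof. by []. Qed.
Fact te_proj_coef (j : J) (b b' : B) :
  te_proj (te_ideal j + b * b') = te_proj b * te_proj b'.
Proof. by rewrite (rmorphD (@te_proj G J)) rmorphM /= te_proj_ideal add0r. Qed.

Fact induced_scaleA c d z :
  induced_scale c (induced_scale d z) = induced_scale (c * d) z.
Proof.
case: c d z => [[a n] [m b]] [[a' n'] [m' b']] [x [q s]]; rewrite nct_mulE.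
rewrite !induced_scale_def te_coef te_proj_coef; congr (_, (_, _)); last 1 first.
- rewrite !scalerDr !tensDr tensDl scale_tens scalerA tens_bal.
  rewrite -linearZ -ideal_act_rscale !linearD ideal_act_tens.
  rewrite -!addrA; congr (_ + _); rewrite addrCA; congr (_ + _).
  by rewrite addrCA; congr (_ + _); rewrite addrCA.
- rewrite scalerDr scalerA -addrA; congr (_ + _); rewrite -[in LHS]tens_bal tensDl pair0D.
  by congr (_ + _); congr (_, _) => /=; rewrite ?scaler0 // scale_tens.
- by rewrite scalerA.
Qed.
Fact induced_scale1 : left_id 1 induced_scale.
Proof.
move=> [x [q s]]; apply: etrans (induced_scale_def 1 0 0 1 x q s) _.
rewrite [(1 : B).2](_ : _ = 0) // rmorph1 linear0 !scale1r !tens0l addr0 add0r.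
by rewrite addr0.
Qed.
Fact induced_scaleDr : right_distributive induced_scale +%R.
Proof.
move=> [[a n] [m b]] [x [q s]] [x' [q' s']].
apply: etrans (induced_scale_def a n m b (x + x') (q + q') (s + s')) _.
rewrite !induced_scale_def; congr (_, (_, _)).
- by rewrite scalerDr tensDr pair0D addrACA.
- by rewrite scalerDr.
- rewrite tensDr scalerDr ideal_actD [RHS]addrACA; congr (_ + _).
  by rewrite addrACA.
Qed.
Fact induced_scaleDl z : {morph induced_scale^~ z : c d / c + d}.
Proof.
case: z => x [q s] [[a n] [m b]] [[a' n'] [m' b']].
apply: etrans (induced_scale_def (a + a') (n + n') (m + m') (b + b') x q s) _.
rewrite !induced_scale_def (rmorphD (@te_proj G J)) [(b + b').2](_ : _ = b.2 + b'.2) //.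
congr (_, (_, _)).
- by rewrite scalerDl tensDl pair0D addrACA.
- by rewrite scalerDl.
- rewrite scalerDl tensDl linearD [RHS]addrACA; congr (_ + _).
  by rewrite addrACA.
Qed.
HB.instance Definition _ := GRing.Zmodule_isLmodule.Build C induced
  induced_scaleA induced_scale1 induced_scaleDr induced_scaleDl.

Lemma induced_scaleE a n m b (x : PQ) (q : Q) (s : tensor M PQ) :
  (((a, n), (m, b)) : C) *: ((x, (q, s)) : induced)
  = (a *: x + (0, tens n q),
     (te_proj b *: q, tens m x + te_proj b *: s + ideal_act q b.2)).
Proof. by []. Qed.

Definition genP (p : P) : induced := ((p, 0), (0, 0)).
Definition genQ (q : Q) : induced := ((0, 0), (q, 0)).
Definition topN (t : tensor N Q) : induced := ((0, t), (0, 0)).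
Definition topM (s : tensor M PQ) : induced := (0, (0, s)).

Lemma inducedE p t q s : ((p, t), (q, s)) = genP p + topN t + genQ q + topM s.
Proof. by congr ((_, _), (_, _)); rewrite /= ?addr0 ?add0r. Qed.

Lemma ideal_act0 j : ideal_act 0 j = 0.
Proof. by apply: (addrI (ideal_act 0 j)); rewrite -ideal_actD !addr0. Qed.

Definition simpI := (induced_scaleE, te_proj0, scale0r, scaler0, @tens0r,
  @tens0l, addr0, add0r, ideal_act0).

Lemma pair_scale (a : A) (p : P) (t : tensor N Q) : a *: (p, t) = (a *: p, a *: t).
Proof. by []. Qed.

Lemma scaleA_genP a p : blockA a *: genP p = genP (a *: p).
Proof. by rewrite /blockA /genP !simpI ?linear0 ?addr0 pair_scale scaler0. Qed.
Lemma scaleN_genQ n q : blockN n *: genQ q = topN (tens n q).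
Proof. by rewrite /blockN /genQ !simpI ?linear0 ?addr0 ?add0r. Qed.
Lemma scaleM_top m x : blockM m *: ((x, (0, 0)) : induced) = topM (tens m x).
Proof. by rewrite /blockM !simpI. Qed.
Lemma scaleB_genQ g q : blockB (te_inj g) *: genQ q = genQ (g *: q).
Proof. by rewrite /blockB /genQ !simpI ?linear0 ?addr0. Qed.

Lemma genPD p p' : genP (p + p') = genP p + genP p'.
Proof. by congr ((_, _), (_, _)); rewrite /= addr0. Qed.
Lemma genQD q q' : genQ (q + q') = genQ q + genQ q'.
Proof. by congr ((_, _), (_, _)); rewrite /= addr0. Qed.
Lemma topND t t' : topN (t + t') = topN t + topN t'.
Proof. by congr ((_, _), (_, _)); rewrite /= addr0. Qed.
Lemma topMD s s' : topM (s + s') = topM s + topM s'.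
Proof. by congr (_, (_, _)); rewrite /= addr0. Qed.
Lemma genP0 : genP 0 = 0. Proof. by []. Qed.
Lemma genQ0 : genQ 0 = 0. Proof. by []. Qed.
Lemma topN0 : topN 0 = 0. Proof. by []. Qed.
Lemma topM0 : topM 0 = 0. Proof. by []. Qed.

(** [P] and [Q] generate the induced module. *)
Lemma induced_ind (S : induced -> Prop) :
  S 0 -> (forall x y, S x -> S y -> S (x + y)) -> (forall c x, S x -> S (c *: x)) ->
  (forall p, S (genP p)) -> (forall q, S (genQ q)) -> forall z, S z.
Proof.
move=> S0 SD SZ SP SQ.
have SN t : S (topN t).
  elim/tensor_ind: t => [//|x y Sx Sy|n q]; first by rewrite topND; apply: SD.
  by rewrite -scaleN_genQ; apply: SZ.
have SX x : S (x, (0, 0)).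
  case: x => p t; have -> : ((p, t), (0, 0)) = genP p + topN t.
    by congr ((_, _), (_, _)); rewrite /= ?addr0 ?add0r.
  by apply: SD.
have SM s : S (topM s).
  elim/tensor_ind: s => [//|x y Sx Sy|m x]; first by rewrite topMD; apply: SD.
  by rewrite -scaleM_top; apply: SZ.
by move=> [[p t] [q s]]; rewrite inducedE; apply: (SD) => //; do 2!apply: (SD) => //.
Qed.

Lemma induced_ext (V : lmodType C) (h k : {linear induced -> V}) :
  (forall p, h (genP p) = k (genP p)) -> (forall q, h (genQ q) = k (genQ q)) ->
  h =1 k.
Proof.
move=> hP hQ; apply: induced_ind => // [|x y ex ey|c x ex].
- by rewrite !linear0.
- by rewrite !linearD ex ey.
- by rewrite !linearZ ex.
Qed.

(** The conditions on [phi] and [psi] force their values into [e_A V] and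
    [e_B V], so that these maps amount to an [A]-linear and a [G]-linear map
    into the rows of [V]. *)
Section Universal.
Variables (V : lmodType C) (phi : P -> V) (psi : Q -> V).
Hypotheses (phiD : {morph phi : x y / x + y}) (psiD : {morph psi : x y / x + y}).
Hypothesis phiZ : forall a p, phi (a *: p) = blockA a *: phi p.
Hypothesis psiZ : forall g q, psi (g *: q) = blockB (te_inj g) *: psi q.

Let phi0 : phi 0 = 0.
Proof. by apply: (addrI (phi 0)); rewrite -phiD !addr0. Qed.
Let psi0 : psi 0 = 0.
Proof. by apply: (addrI (psi 0)); rewrite -psiD !addr0. Qed.
Let phi1 p : phi p = blockA 1 *: phi p.
Proof. by rewrite -phiZ scale1r. Qed.
Let psi1 q : psi q = blockB 1 *: psi q.
Proof. by rewrite -[1]/(te_inj 1) -psiZ scale1r. Qed.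

Let hN (n : N) (q : Q) := blockN n *: psi q.
Let hN_bal : balanced hN.
Proof.
split=> [n n' q|n q q'|n g q]; rewrite /hN.
- by rewrite blockND scalerDl.
- by rewrite psiD scalerDr.
- by rewrite psiZ scalerA blockNB.
Qed.
Let liftX (x : PQ) := phi x.1 + tlift hN x.2.
Let liftXD x y : liftX (x + y) = liftX x + liftX y.
Proof. by rewrite /liftX phiD (tliftD hN_bal) addrACA. Qed.
Let liftX0 : liftX 0 = 0.
Proof. by apply: (addrI (liftX 0)); rewrite -liftXD !addr0. Qed.
Let liftX_tens n q : liftX (0, tens n q) = blockN n *: psi q.
Proof. by rewrite /liftX phi0 add0r (tlift_tens hN_bal). Qed.

Let scale_liftX (c : C) x :
  c *: liftX x = liftX (c.1.1 *: x) + blockM c.2.1 *: liftX x.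
Proof.
case: c x => [[a n] [m b]] [p t]; rewrite /liftX /=.
rewrite !scalerDr addrACA.
congr (_ + _).
  rewrite phiZ [in LHS]phi1 scalerA blockE !mulrDl !blockMul !addr0 mulr1 rscale1.
  by rewrite scalerDl.
elim/tensor_ind: t => [|t t' e e'|n' q].
- by rewrite scaler0 (tlift0 hN_bal) !scaler0 addr0.
- by rewrite scalerDr !(tliftD hN_bal) !scalerDr e e' addrACA.
rewrite scale_tens !(tlift_tens hN_bal) /hN !scalerA blockE !mulrDl !blockMul.
by rewrite !addr0 scalerDl.
Qed.

Let hM (m : M) (x : PQ) := blockM m *: liftX x.
Let hM_bal : balanced hM.
Proof.
split=> [m m' x|m x x'|m a x]; rewrite /hM.
- by rewrite blockMD scalerDl.
- by rewrite liftXD scalerDr.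
rewrite -blockMA -scalerA; congr (_ *: _).
by rewrite [LHS]scale_liftX -[blockM 0]/(0 : C) scale0r addr0.
Qed.
Let liftZ (z : induced) := liftX z.1 + (psi z.2.1 + tlift hM z.2.2).
Let liftZD x y : liftZ (x + y) = liftZ x + liftZ y.
Proof.
rewrite /liftZ liftXD psiD (tliftD hM_bal) [RHS]addrACA; congr (_ + _).
by rewrite addrACA.
Qed.

Let scale_liftM (c : C) s :
  c *: tlift hM s = tlift hM (te_proj c.2.2 *: s).
Proof.
case: c => [[a n] [m b]] /=.
elim/tensor_ind: s => [|s s' e e'|m' x].
- by rewrite scaler0 (tlift0 hM_bal) scaler0.
- by rewrite scalerDr !(tliftD hM_bal) scalerDr e e'.
rewrite scale_tens !(tlift_tens hM_bal) /hM scalerA blockE !mulrDl !blockMul.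
by rewrite !add0r.
Qed.

Let scale_psi (c : C) q :
  c *: psi q = blockN c.1.2 *: psi q
    + (psi (te_proj c.2.2 *: q) + tlift hM (ideal_act q c.2.2.2)).
Proof.
case: c => [[a n] [m b]]; rewrite [_.1.2]/= [_.2.2]/=.
have -> : tlift hM (ideal_act q b.2) = blockB (te_ideal b.2) *: psi q.
  elim/tensor_ind: b.2 => [|j j' e e'|m' n'].
  - by rewrite linear0 (tlift0 hM_bal) te_ideal0 scale0r.
  - by rewrite linearD (tliftD hM_bal) te_idealD blockBD scalerDl e e'.
  by rewrite ideal_act_tens (tlift_tens hM_bal) /hM liftX_tens scalerA blockMN.
rewrite psiZ -scalerDl -blockBD [te_inj _ + _](_ : _ = b); last first.
  by case: (b) => g j; congr (_, _); rewrite /= ?addr0 ?add0r.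
rewrite [in LHS]psi1 scalerA blockE !mulrDl !blockMul rmorph1 mulr1 rscale1.
by rewrite add0r addr0 scalerDl.
Qed.

(** Together with [induced_ext] this is the universal property of the induced
    module, from which both its projectivity and the description of the Hom
    complex into [C] are read off. *)
Lemma induced_lift : exists h : {linear induced -> V},
  (forall p, h (genP p) = phi p) /\ (forall q, h (genQ q) = psi q).
Proof.
have hZ c z : liftZ (c *: z) = c *: liftZ z.
  case: z => x [q s].
  have liftZE y r u : liftZ (y, (r, u)) = liftX y + (psi r + tlift hM u) by [].
  have -> : c *: ((x, (q, s)) : induced) = (c.1.1 *: x + (0, tens c.1.2 q),
     (te_proj c.2.2 *: q, tens c.2.1 x + te_proj c.2.2 *: s + ideal_act q c.2.2.2)).
    by case: c => [[a n] [m b]]; rewrite induced_scaleE.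
  rewrite !liftZE scalerDr [c *: (psi q + _)]scalerDr.
  rewrite scale_liftX scale_psi scale_liftM.
  rewrite liftXD liftX_tens !(tliftD hM_bal) (tlift_tens hM_bal) -!addrA.
  do 2!congr (_ + _); rewrite -/(hM c.2.1 x) [RHS]addrCA; congr (_ + _).
  by rewrite [RHS]addrCA; do 2!congr (_ + _); apply: addrC.
have hl : linear liftZ by move=> c x y; rewrite liftZD hZ.
exists (lin_of hl); split=> [p|q]; rewrite lin_ofE /liftZ /=.
  by rewrite psi0 /liftX /= (tlift0 hN_bal) (tlift0 hM_bal) !addr0.
by rewrite liftX0 (tlift0 hM_bal) add0r addr0.
Qed.
End Universal.
End Induced.
End Blocks.
Arguments genP {A G} M N {P} Q p.
Arguments genQ {A G} M N P {Q} q.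
Arguments topN {A G} M {N} P {Q} t.
Arguments topM {A G M N P Q} s.
Arguments blockA {A G} M N a.
Arguments blockN {A G} M {N} n.
Arguments blockM {A G M} N m.
Arguments blockB {A G M N} b.

(** * The induced complex *)

Lemma fin_gen_fin (R : pzRingType) (V : lmodType R) (I : finType) (e : I -> V) :
  (forall v, exists c : I -> R, v = \sum_i c i *: e i) -> fin_gen V.
Proof.
move=> eP; exists #|I|, (fun k => e (enum_val k)) => v.
have [c ->] := eP v; exists (fun k => c (enum_val k)).
by rewrite -(big_enum_val (fun i => c i *: e i)).
Qed.

Section InducedModule.
Variables (A G : pzRingType) (M : bimodType G A) (N : bimodType A G).
Local Notation J := (tensor M N).
Local Notation B := (trivext G J).
Local Notation C := (nctensor M N).

Section FGProj.
Variables (P : lmodType A) (Q : lmodType G).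
Local Notation T := (induced M N P Q).

Lemma blockA_sum n (c : 'I_n -> A) (p : 'I_n -> P) :
  genP M N Q (\sum_i c i *: p i) = \sum_i blockA M N (c i) *: genP M N Q (p i) .
Proof.
rewrite (big_morph (genP M N Q) (@genPD _ _ M N P Q) (genP0 _ _ _ _)).
by apply: eq_bigr => i _; rewrite scaleA_genP.
Qed.

Lemma blockB_sum n (c : 'I_n -> G) (q : 'I_n -> Q) :
  genQ M N P (\sum_i c i *: q i)
  = \sum_i blockB (te_inj (c i) : B) *: genQ M N P (q i).
Proof.
rewrite (big_morph (genQ M N P) (@genQD _ _ M N P Q) (genQ0 _ _ _ _)).
by apply: eq_bigr => i _; rewrite scaleB_genQ.
Qed.

Lemma induced_fin_gen : fin_gen P -> fin_gen Q -> fin_gen T.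
Proof.
move=> [m [e eP]] [n [e' e'P]].
pose g (i : 'I_m + 'I_n) : T :=
  match i with inl j => genP M N Q (e j) | inr j => genQ M N P (e' j) end.
apply: (fin_gen_fin (e := g)); apply: induced_ind => [|x y [c ->] [d ->]|r x [c ->]|p|q].
- by exists (fun=> 0); rewrite big1 // => i _; rewrite scale0r.
- exists (fun i => c i + d i); rewrite -big_split.
  by apply: eq_bigr => i _; rewrite scalerDl.
- exists (fun i => r * c i); rewrite scaler_sumr.
  by apply: eq_bigr => i _; rewrite scalerA.
- have [c ->] := eP p.
  exists (fun i => if i is inl j then blockA M N (c j) else 0).
  rewrite big_sumType /= blockA_sum [X in _ = _ + X]big1 ?addr0 // => i _.
  exact: scale0r.
- have [c ->] := e'P q.
  exists (fun i => if i is inr j then blockB (te_inj (c j) : B) else 0).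
  rewrite big_sumType /= blockB_sum [X in _ = X + _]big1 ?add0r // => i _.
  exact: scale0r.
Qed.

(** With dual bases of [P] and [Q], a lift is prescribed freely on the
    generators and extended by the universal property. *)
Lemma induced_projective : fin_gen P -> projective P -> fin_gen Q ->
  projective Q -> projective T.
Proof.
move=> fgP prP fgQ prQ V W p h p_surj.
have [m [e [c cE]]] := dual_basis fgP prP.
have [n [e' [d dE]]] := dual_basis fgQ prQ.
have [v vE] : exists v : 'I_m -> V, forall i, p (v i) = h (genP M N Q (e i)).
  by exists (fun i => projT1 (cid (p_surj (h (genP M N Q (e i)))))) => i; case: cid.
have [w wE] : exists w : 'I_n -> V, forall i, p (w i) = h (genQ M N P (e' i)).
  by exists (fun i => projT1 (cid (p_surj (h (genQ M N P (e' i)))))) => i; case: cid.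
pose phi x := \sum_i blockA M N (c i x) *: v i.
pose psi x := \sum_i blockB (te_inj (d i x : G) : B) *: w i.
have phiD : {morph phi : x y / x + y}.
  move=> x y; rewrite -big_split; apply: eq_bigr => i _.
  by rewrite linearD blockAD scalerDl.
have psiD : {morph psi : x y / x + y}.
  move=> x y; rewrite -big_split; apply: eq_bigr => i _.
  by rewrite linearD rmorphD blockBD scalerDl.
have phiZ a x : phi (a *: x) = blockA M N a *: phi x.
  rewrite scaler_sumr; apply: eq_bigr => i _.
  by rewrite linearZ scalerA blockAA.
have psiZ g x : psi (g *: x) = blockB (te_inj g : B) *: psi x.
  rewrite scaler_sumr; apply: eq_bigr => i _.
  by rewrite linearZ rmorphM scalerA blockBB.
have [k [kP kQ]] := induced_lift phiD psiD phiZ psiZ.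
have pkl : linear (fun z => p (k z)) by move=> r x y; rewrite !linearP.
exists k; apply: (induced_ext (h := lin_of pkl)) => [x|x]; rewrite lin_ofE.
  rewrite kP linear_sum [in RHS](cE x) blockA_sum linear_sum.
  by apply: eq_bigr => i _; rewrite !linearZ vE.
rewrite kQ linear_sum [in RHS](dE x) blockB_sum linear_sum.
by apply: eq_bigr => i _; rewrite !linearZ wE.
Qed.
End FGProj.

Section InducedComplex.
Variables (P : complex A) (Q : complex G).
Variables (s : forall i, {linear P i -> tensor_cx N Q (1 + i)}) (sP : twisting s).
Local Notation X := (twisted sP).
Variables (t : forall i, {linear Q i -> tensor_cx M X (1 + i)}) (tP : twisting t).
Local Notation Y := (twisted tP).
Local Notation T i := (induced M N (P i) (Q i)).

(** The rows of the induced complex are two nested twisted sums: the upper row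
    extends [P] by [N (x) Q], and the lower row extends [Q] by the tensor
    product of [M] with the upper row. *)
Definition induced_diff i (z : T i) : T (1 + i) := (cdiff X i z.1, cdiff Y i z.2).

Lemma diff_topN i n (q : Q i) :
  cdiff X i (0, tens n q) = (0, tens n (cdiff Q i q)).
Proof.
have XE x u : cdiff X i (x, u) = (cdiff P i x, s i x + tmapL N (cdiff Q i) u) by [].
by rewrite XE !linear0 add0r tmapL_tens.
Qed.

Lemma diff_ideal_act i j (q : Q i) :
  tmapL M (cdiff X i) (ideal_act M N (P i) q j) = ideal_act M N (P (1 + i)) (cdiff Q i q) j.
Proof.
elim/tensor_ind: j => [|x y ex ey|m n]; first by rewrite !linear0.
  by rewrite !linearD ex ey.
by rewrite !ideal_act_tens tmapL_tens diff_topN.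
Qed.

Fact induced_diff_linear i : linear (@induced_diff i).
Proof.
have dD x y : induced_diff (x + y) = induced_diff x + induced_diff y :> T (1 + i).
  by congr (_, _); rewrite linearD.
move=> c z w; rewrite dD; congr (_ + _).
case: c z {w} => [[a n] [m b]] [x [q u]].
have YE q' u' : cdiff Y i (q', u')
  = (cdiff Q i q', t i q' + tmapL M (cdiff X i) u') by [].
have dE x' q' u' : @induced_diff i (x', (q', u'))
  = (cdiff X i x', (cdiff Q i q', t i q' + tmapL M (cdiff X i) u')) by [].
rewrite induced_scaleE !dE induced_scaleE; congr (_, (_, _)).
- by rewrite linearD linearZ diff_topN.
- by rewrite linearZ.
- rewrite !linearD !linearZ_LR tmapL_tens diff_ideal_act scalerDr.
  by rewrite -!addrA; apply: addrCA.
Qed.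

Fact induced_diffK i z :
  lin_of (@induced_diff_linear (1 + i)) (lin_of (@induced_diff_linear i) z) = 0.
Proof.
by congr (_, _); [apply: (@cdiffK _ X) | apply: (@cdiffK _ Y)].
Qed.
Definition induced_cx : complex C := Complex induced_diffK.

Lemma induced_exact : exact_cx X -> exact_cx Y -> exact_cx induced_cx.
Proof.
move=> exX exY i z dz.
have [x xE] := exX i z.1 (congr1 fst dz); have [y yE] := exY i z.2 (congr1 snd dz).
by exists (x, y); case: z xE yE {dz} => z1 z2 /= <- <-.
Qed.

Lemma diff_genP i p :
  induced_diff (genP M N (Q i) p)
  = genP M N (Q (1 + i)) (cdiff P i p) + topN M (P (1 + i)) (s i p).
Proof.
congr (_, _); last by rewrite addr0 [LHS]linear0.
congr (_, _); first by rewrite /= addr0.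
by rewrite add0r [_ (0 : tensor N (Q i))]linear0 addr0.
Qed.

Lemma diff_genQ i q :
  induced_diff (genQ M N (P i) q) = genQ M N (P (1 + i)) (cdiff Q i q) + topM (t i q).
Proof.
congr (_, _); first by rewrite addr0 [LHS]linear0.
congr (_, _); first by rewrite /= addr0.
by rewrite add0r [_ (0 : tensor M _)]linear0 addr0.
Qed.

Lemma blockA_scale a (c : C) :
  (blockA M N a : C) *: (c : C^o) = ((a * c.1.1, a *: c.1.2), (0, 0)) :> C.
Proof.
case: c => [[a' n] [m b]]; apply: etrans (nct_mulE _ _ _ _ _ _ _ _) _.
by rewrite !simpC.
Qed.
Lemma blockN_scale n (c : C) :
  (blockN M n : C) *: (c : C^o) = ((0, rscale n (te_proj c.2.2)), (0, 0)) :> C.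
Proof.
case: c => [[a' n'] [m b]]; apply: etrans (nct_mulE _ _ _ _ _ _ _ _) _.
by rewrite !simpC.
Qed.
Lemma blockM_scale m (c : C) :
  (blockM N m : C) *: (c : C^o) = ((0, 0), (rscale m c.1.1, te_ideal (tens m c.1.2))) :> C.
Proof.
case: c => [[a' n] [m' b]]; apply: etrans (nct_mulE _ _ _ _ _ _ _ _) _.
by rewrite !simpC.
Qed.
Lemma blockB_scale b (c : C) :
  (blockB b : C) *: (c : C^o) = ((0, 0), (te_proj b *: c.2.1, b * c.2.2)) :> C.
Proof.
case: c => [[a' n] [m b']]; apply: etrans (nct_mulE _ _ _ _ _ _ _ _) _.
by rewrite !simpC.
Qed.

Section Vanishing.
Variables (i : int) (h : {linear induced_cx i -> C^o}).

Lemma hom_genP p : h (genP M N (Q i) p) = ((h (genP M N (Q i) p) : C).1, 0).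
Proof.
have -> : genP M N (Q i) p = blockA M N 1 *: genP M N (Q i) p.
  by rewrite scaleA_genP scale1r.
by rewrite linearZ_LR blockA_scale.
Qed.

Lemma hom_genQ q :
  h (genQ M N (P i) q) = (0, (h (genQ M N (P i) q) : C).2).
Proof.
have -> : genQ M N (P i) q = blockB (te_inj 1 : B) *: genQ M N (P i) q.
  by rewrite scaleB_genQ scale1r.
by rewrite linearZ_LR blockB_scale.
Qed.

(** The lower row entries coming from [M (x) X] are multiples [blockM m * c],
    whose lower right entry lies in [J]. *)
Lemma te_proj_hom_topM u : te_proj (h (topM u) : C).2.2 = 0.
Proof.
elim/tensor_ind: u => [|x y ex ey|m x]; first by rewrite topM0 linear0.
  by rewrite topMD linearD [te_proj _](_ : _ = te_proj (h (topM x) : C).2.2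
    + te_proj (h (topM y) : C).2.2) // ex ey addr0.
by rewrite -scaleM_top linearZ_LR blockM_scale.
Qed.

Fact hom_partA_linear : linear (fun p => (h (genP M N (Q i) p) : C).1.1 : A^o).
Proof.
by move=> a p p'; rewrite genPD linearD -scaleA_genP linearZ_LR blockA_scale.
Qed.
Fact hom_partN_linear : linear (fun p => (h (genP M N (Q i) p) : C).1.2).
Proof.
by move=> a p p'; rewrite genPD linearD -scaleA_genP linearZ_LR blockA_scale.
Qed.
Fact hom_partM_linear : linear (fun q => (h (genQ M N (P i) q) : C).2.1).
Proof.
by move=> g q q'; rewrite genQD linearD -scaleB_genQ linearZ_LR blockB_scale.
Qed.
Fact hom_partG_linear :
  linear (fun q => te_proj (h (genQ M N (P i) q) : C).2.2 : G^o).
Proof.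
by move=> g q q'; rewrite genQD linearD -scaleB_genQ linearZ_LR blockB_scale.
Qed.
Fact hom_partJ_linear : linear (fun q => (h (genQ M N (P i) q) : C).2.2.2).
Proof.
move=> g q q'; rewrite genQD linearD -scaleB_genQ linearZ_LR blockB_scale.
have E (b : B) : (te_inj g * b).2 = g *: b.2.
  by rewrite [LHS](_ : _ = g *: b.2 + rscale 0 b.1) // rscale0l addr0.
by rewrite -E.
Qed.

Hypothesis hQ : forall q, te_proj (h (genQ M N (P i) q) : C).2.2 = 0.

(** [N] multiplies the lower row of [C] through its [G]-component only. *)
Lemma hom_topN0 u : h (topN M (P i) u) = 0.
Proof.
elim/tensor_ind: u => [|x y ex ey|n q]; first by rewrite topN0 linear0.
  by rewrite topND linearD ex ey addr0.
by rewrite -scaleN_genQ linearZ_LR blockN_scale hQ rscale0r.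
Qed.

Hypothesis hP : forall p, h (genP M N (Q i) p) = 0.

Lemma hom_topM0 u : h (topM u) = 0.
Proof.
elim/tensor_ind: u => [|x y ex ey|m [p v]]; first by rewrite topM0 linear0.
  by rewrite topMD linearD ex ey addr0.
rewrite -scaleM_top linearZ_LR.
have -> : ((p, v), (0, 0)) = genP M N (Q i) p + topN M (P i) v.
  by congr ((_, _), (_, _)); rewrite /= ?addr0 ?add0r.
by rewrite linearD hP hom_topN0 addr0 scaler0.
Qed.
End Vanishing.

(** A map [h] from the induced complex to [C] is a pair of maps, from [P] to the
    upper row [A + N] and from [Q] to the lower row [M + J + G] of [C]. The
    twistings mix the two, but they lower the filtration of [C] whose
    successive quotients are [G], then [A + N], then [M + J]. So a cocycle is
    bounded one layer at a time: after each layer a coboundary is subtracted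
    and the remaining cocycle lies deeper in the filtration. *)
Section HomExact.
Hypotheses (PA : hom_exact P A^o) (PN : hom_exact P N).
Hypotheses (QM : hom_exact Q M) (QJ : hom_exact Q J) (QG : hom_exact Q G^o).
Variable i : int.
Local Notation D := (cdiff induced_cx).
Local Notation gP k := (genP M N (Q k)).
Local Notation gQ k := (genQ M N (P k)).

Let prG (c : C) : G := te_proj c.2.2.
Let prGB (c d : C^o) : prG (c - d) = prG c - prG d. Proof. by []. Qed.
Let prGD (c d : C^o) : prG (c + d) = prG c + prG d. Proof. by []. Qed.
Let prG_topM k (h : {linear induced_cx k -> C^o}) u : prG (h (topM u)) = 0.
Proof. exact: te_proj_hom_topM. Qed.

Let kills_diff (h : {linear induced_cx (1 + i) -> C^o}) :=
  forall x, h (D i x) = 0.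
Let extends (h : {linear induced_cx (1 + i) -> C^o}) :=
  exists k : {linear induced_cx (1 + (1 + i)) -> C^o},
    forall y, k (D (1 + i) y) = h y.

Let kills_genP h p : kills_diff h ->
  h (gP (1 + i) (cdiff P i p)) = - h (topN M (P (1 + i)) (s i p)).
Proof.
by move=> /(_ (gP i p)); rewrite [D _ _]diff_genP linearD => /eqP; rewrite addr_eq0 => /eqP.
Qed.
Let kills_genQ h q : kills_diff h ->
  h (gQ (1 + i) (cdiff Q i q)) = - h (topM (t i q)).
Proof.
by move=> /(_ (gQ i q)); rewrite [D _ _]diff_genQ linearD => /eqP; rewrite addr_eq0 => /eqP.
Qed.

Let extends_sub h (k : {linear induced_cx (1 + (1 + i)) -> C^o}) :
  kills_diff h ->
  (forall h', kills_diff h' -> (forall y, h' y = h y - k (D (1 + i) y)) -> extends h') ->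
  extends h.
Proof.
move=> hd hk; have h'l : linear (fun y => h y - k (D (1 + i) y)).
  by move=> c x y; rewrite !linearP scalerDr addrACA.
have [x|//|k' k'E] := hk (lin_of h'l).
  by rewrite lin_ofE hd (@cdiffK _ induced_cx) linear0 subr0.
have kl : linear (fun y => k y + k' y).
  by move=> c x y; rewrite !linearP scalerDr addrACA.
by exists (lin_of kl) => y; rewrite lin_ofE k'E lin_ofE addrC subrK.
Qed.

(** The deepest layer: [h] vanishes on [P] and maps [Q] into [M + J]. *)
Let extends_top h : kills_diff h ->
  (forall q, te_proj (h (gQ (1 + i) q) : C).2.2 = 0) ->
  (forall p, h (gP (1 + i) p) = 0) -> extends h.
Proof.
move=> hd hQ hP.
have hdQ q : h (gQ (1 + i) (cdiff Q i q)) = 0 by rewrite kills_genQ // hom_topM0 // oppr0.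
have [q|kM kME] := QM (h := lin_of (hom_partM_linear h)).
  by rewrite lin_ofE hdQ.
have [q|kJ kJE] := QJ (h := lin_of (hom_partJ_linear h)).
  by rewrite lin_ofE hdQ.
pose phi (p : P (1 + (1 + i))) : C^o := 0.
pose psi q : C^o := blockM N (kM q) + blockB (te_ideal (kJ q) : B).
have [|||g q|k [kP kQ]] := @induced_lift _ _ M N _ _ _ phi psi.
- by move=> x y; rewrite /phi addr0.
- by move=> x y; rewrite /psi !linearD blockMD te_idealD blockBD addrACA.
- by move=> a p; rewrite /phi scaler0.
- rewrite /psi !linearZ_LR scalerDr [X in _ = X + _]blockBM [X in _ = _ + X]blockBB.
  by rewrite te_mul_ideal.
have kQ0 q : te_proj (k (gQ _ q) : C).2.2 = 0 by rewrite kQ [LHS](_ : _ = 0 + 0) // addr0.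
have kP0 p : k (gP _ p) = 0 by rewrite kP.
have kdl : linear (fun y => k (D (1 + i) y)) by move=> c x y; rewrite !linearP.
exists k; apply: (induced_ext (h := lin_of kdl)) => x; rewrite lin_ofE.
  by rewrite [D _ _]diff_genP linearD kP0 hom_topN0 // addr0 hP.
rewrite [D _ _]diff_genQ linearD hom_topM0 // addr0 kQ /psi kME kJE !lin_ofE.
rewrite [RHS]hom_genQ; move: (hQ x); case: (h _) => [[a n] [m [g j]]] /= g0.
by congr ((_, _), (_, (_, _))); rewrite /= ?addr0 ?add0r.
Qed.

(** The next layer: the upper row component of [h] on [P] is a cocycle. *)
Let extends_middle h : kills_diff h ->
  (forall q, te_proj (h (gQ (1 + i) q) : C).2.2 = 0) -> extends h.
Proof.
move=> hd hQ.
have hdP p : h (gP (1 + i) (cdiff P i p)) = 0 by rewrite kills_genP // hom_topN0 // oppr0.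
have [p|kA kAE] := PA (h := lin_of (hom_partA_linear h)).
  by rewrite lin_ofE hdP.
have [p|kN kNE] := PN (h := lin_of (hom_partN_linear h)).
  by rewrite lin_ofE hdP.
pose phi p : C^o := blockA M N (kA p) + blockN M (kN p).
pose psi (q : Q (1 + (1 + i))) : C^o := 0.
have [|||g q|k [kP kQ]] := @induced_lift _ _ M N _ _ _ phi psi.
- by move=> x y; rewrite /phi !linearD blockAD blockND addrACA.
- by move=> x y; rewrite /psi addr0.
- move=> a p; rewrite /phi !linearZ_LR scalerDr [X in _ = X + _]blockAA.
  by rewrite [X in _ = _ + X]blockAN.
- by rewrite /psi scaler0.
have kQ0 q : k (gQ _ q) = 0 by rewrite kQ.
have kQ1 q : te_proj (k (gQ _ q) : C).2.2 = 0 by rewrite kQ0.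
apply: (extends_sub (k := k)) => // h' h'd h'E; apply: extends_top => // x.
  rewrite h'E [D _ _]diff_genQ linearD kQ0 add0r.
  by rewrite [LHS]prGB prG_topM [prG _]hQ subr0.
rewrite h'E [D _ _]diff_genP linearD [X in _ - (_ + X)]hom_topN0 // addr0.
rewrite kP /phi kAE kNE !lin_ofE.
rewrite [X in X - _]hom_genP; case: (h _) => [[a n] b] /=.
by congr ((_, _), (_, _)); rewrite /= ?(addr0, add0r) ?subrr ?oppr0.
Qed.

(** The outermost layer: the [G]-component of [h] on [Q] is a cocycle. *)
Lemma induced_hom_exact_at (h : {linear induced_cx (1 + i) -> C^o}) :
  (forall x, h (cdiff induced_cx i x) = 0) ->
  exists k : {linear induced_cx (1 + (1 + i)) -> C^o},
    forall y, k (cdiff induced_cx (1 + i) y) = h y.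
Proof.
move=> hd.
have [q|kG kGE] := QG (h := lin_of (hom_partG_linear h)).
  rewrite lin_ofE kills_genQ // -[- _]sub0r [LHS]prGB prG_topM.
  by rewrite subr0.
pose phi (p : P (1 + (1 + i))) : C^o := 0.
pose psi q : C^o := blockB (te_inj (kG q : G) : B).
have [|||g q|k [kP kQ]] := @induced_lift _ _ M N _ _ _ phi psi.
- by move=> x y; rewrite /phi addr0.
- by move=> x y; rewrite /psi linearD rmorphD blockBD.
- by move=> a p; rewrite /phi scaler0.
- by rewrite /psi linearZ_LR [RHS]blockBB -rmorphM.
apply: (extends_sub (k := k)) => // h' h'd h'E; apply: extends_middle => // x.
rewrite h'E [D _ _]diff_genQ linearD kQ /psi kGE.
by rewrite [LHS]prGB prGD prG_topM addr0; apply: subrr.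
Qed.
End HomExact.

Lemma induced_totally_exact :
  hom_exact P A^o -> hom_exact P N -> hom_exact Q M -> hom_exact Q J ->
  hom_exact Q G^o -> exact_cx X -> exact_cx Y -> totally_exact induced_cx.
Proof.
move=> PA PN QM QJ QG exX exY; split; first exact: induced_exact.
by move=> i h; apply: induced_hom_exact_at.
Qed.
End InducedComplex.
End InducedModule.

(** * Kernels, quotients and right exactness *)

Lemma inj_surj_bijective (S T : Type) (f : S -> T) :
  injective f -> (forall y, exists x, f x = y) -> bijective f.
Proof.
move=> f_inj f_surj; exists (fun y => projT1 (cid (f_surj y))).
  by move=> x; apply: f_inj; case: cid.
by move=> y; case: cid.
Qed.

Lemma iso_kernel_map (R : pzRingType) (P : complex R) (L : lmodType R) :
  lmod_iso L (submod (ker (cdiff P 0))) <-> exists b : {linear L -> P 0}, kernel_map b.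
Proof.
split=> [[f [f' fK f'K]]|[b [b_inj bE]]].
  have bl : linear (fun x => val (f x)) by move=> a x y; rewrite !linearP.
  exists (lin_of bl); split=> [x y /val_inj/(can_inj fK)//|y].
  split=> [dy|[l <-]]; last by apply/eqP; apply: (valP (f l)).
  have yk : y \in ker (cdiff P 0) by apply/eqP.
  by exists (f' (Sub y yk)); rewrite lin_ofE f'K.
have bk l : b l \in ker (cdiff P 0) by apply/eqP/bE; exists l.
have fl : linear (fun l => Sub (b l) (bk l) : submod (ker (cdiff P 0))).
  by move=> a x y; apply: val_inj; rewrite /= linearP.
exists (lin_of fl); apply: inj_surj_bijective => [x y [/b_inj]//|[y yk]].
have /eqP/bE[l lE] := yk.
by exists l; apply: val_inj.
Qed.

Lemma kernel_map_fin_gen (R : pzRingType) (P : complex R) (L : lmodType R)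
    (b : {linear L -> P 0}) :
  exact_cx P -> fin_gen (P (Negz 0)) -> kernel_map b -> fin_gen L.
Proof.
move=> exP fgP bK; have [s [_ s_surj]] := kernel_map_cover exP bK.
exact: fin_gen_image s_surj fgP.
Qed.

Lemma quotmod_pi_linear (R : pzRingType) (V : lmodType R) (S : submodClosed V) :
  linear (quotmod_pi S).
Proof. by move=> a x y; rewrite quotmod_piD quotmod_piZ. Qed.

Lemma quotmod_pi_surj (R : pzRingType) (V : lmodType R) (S : submodClosed V)
  (v : quotmod S) : exists x, quotmod_pi S x = v.
Proof. by exists (quotmod_repr v); apply: quotmod_reprK. Qed.

(** The usual argument: [u (x) l |-> u (x) (any preimage of l)] is well defined
    modulo the image of [U (x) K], and inverts the map from the cokernel. *)
Lemma tensor_right_exact (R S : pzRingType) (U : bimodType R S)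
    (K X L : lmodType S) (i : {linear K -> X}) (p : {linear X -> L}) :
  (forall l, exists x, p x = l) -> (forall x, p x = 0 -> exists k, i k = x) ->
  forall t, tmapL U p t = 0 -> exists k, tmapL U i k = t.
Proof.
move=> p_surj p_ker t pt.
pose S0 : submodClosed (tensor U X) := im (tmapL U i).
pose s l := projT1 (cid (p_surj l)).
have sE l : p (s l) = l by rewrite /s; case: cid.
pose h (u : U) l := quotmod_pi S0 (tens u (s l)).
have hE u x l : p x = l -> h u l = quotmod_pi S0 (tens u x).
  move=> xl; apply/eqP; rewrite quotmod_eq; apply/asboolP.
  have [|k kE] := p_ker (s l - x); first by rewrite linearB sE xl subrr.
  exists (tens u k); rewrite tmapL_tens kE; apply/eqP.
  by rewrite eq_sym subr_eq -tensDr subrK.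
have hB : balanced h.
  split=> [u u' l|u l l'|u a l].
  - by rewrite /h tensDl quotmod_piD.
  - by rewrite (hE u (s l + s l')) ?tensDr ?quotmod_piD // linearD !sE.
  - by rewrite (hE u (a *: s l)) ?linearZ_LR ?sE // /h tens_bal.
have hp x : tlift h (tmapL U p x) = quotmod_pi S0 x.
  elim/tensor_ind: x {pt} => [|x y ex ey|u x].
  - by rewrite linear0 (tlift0 hB); apply/esym/eqP; rewrite quotmod_pi_eq0 rpred0.
  - by rewrite linearD (tliftD hB) ex ey quotmod_piD.
  - by rewrite tmapL_tens (tlift_tens hB) (hE u x).
have /asboolP[k kE] : t \in S0.
  by rewrite -quotmod_pi_eq0 -hp pt (tlift0 hB).
by exists k.
Qed.

Lemma lmod_iso_resl (R S : pzRingType) (phi : {rmorphism R -> S})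
    (V W : lmodType S) : lmod_iso V W -> lmod_iso (resl phi V) (resl phi W).
Proof.
case=> f f_bij; have fl : linear (f : resl phi V -> resl phi W).
  by move=> a x y; rewrite linearP.
by exists (lin_of fl).
Qed.

Lemma tlift_resl_linear (R S T : pzRingType) (phi : {rmorphism R -> S})
    (U : bimodType S T) (V : lmodType T) (W : lmodType R) (h : U -> V -> W) :
  balanced h -> (forall r u v, h (phi r *: u) v = r *: h u v) ->
  linear (tlift h : resl phi (tensor U V) -> W).
Proof.
move=> hB hZ a x y; rewrite (tliftD hB); congr (_ + _).
rewrite -[a *: x]/(phi a *: (x : tensor U V)).
elim/tensor_ind: x => [|x1 x2 e1 e2|u v].
- by rewrite scaler0 (tlift0 hB) scaler0.
- by rewrite scalerDr !(tliftD hB) e1 e2 scalerDr.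
- by rewrite scale_tens !(tlift_tens hB) hZ.
Qed.

(** * The canonical maps of a quadruple *)

(** The maps [fG], [gG] and [jG] are the canonical maps that [f], [g] and the
    action of [J] induce on [M (x) X], [N (x) V] and [J (x) V], all tensor
    products being taken over [A] or [G]. Working over [G] instead of [B] is
    harmless, since [B] acts on [M], [N], [J] and [coker f] through [G]. *)
Section Quadruples.
Variables (A G : pzRingType) (M : bimodType G A) (N : bimodType A G).
Local Notation J := (tensor M N).
Local Notation B := (trivext G J).
Local Notation MB := (left_over_B M N).
Local Notation NB := (right_over_B M N).
Local Notation JB := (ideal_over_B M N).
Variables (X : lmodType A) (Y : lmodType B).
Variables (f : {linear tensor MB X -> Y}) (g : {linear tensor NB Y -> X}).
Hypothesis fgP : is_quadruple f g.
Local Notation YG := (resl (@te_inj G J) Y).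
Local Notation V := (resl (@te_inj G J) (coker f)).
Local Notation U := (coker g).

Lemma te_split (b : B) : b = te_inj b.1 + te_ideal b.2.
Proof. by case: b => x j; congr (_, _); rewrite /= ?addr0 ?add0r. Qed.

Lemma scale_coker (b : B) (z : coker f) : b *: z = te_inj (te_proj b) *: z.
Proof. by rewrite {1}[b]te_split scalerDl (coker_ideal fgP) addr0. Qed.

Lemma g_f0 n t : g (tens (n : NB) (f t)) = 0.
Proof.
elim/tensor_ind: t => [|x y ex ey|m x]; first by rewrite linear0 tens0r linear0.
  by rewrite linearD tensDr linearD ex ey addr0.
by case: fgP.
Qed.

Lemma ideal_f0 j t : te_ideal j *: f t = 0.
Proof.
elim/tensor_ind: j => [|x y ex ey|m n]; first by rewrite te_ideal0 scale0r.
  by rewrite te_idealD scalerDl ex ey addr0.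
by have [_ <-] := fgP; rewrite g_f0 tens0r linear0.
Qed.

Definition actM (m : M) (x : X) : YG := f (tens (m : MB) x).
Fact actM_bal : balanced actM.
Proof.
split=> [m m' x|m x x'|m a x]; rewrite /actM.
- by rewrite -linearD -[in RHS](@tensDl _ MB).
- by rewrite (@tensDr _ MB) linearD.
- by rewrite -(@tens_bal _ MB).
Qed.
Fact actM_scale r m x : actM (r *: m) x = r *: actM m x.
Proof.
rewrite /actM [RHS](_ : _ = te_inj r *: f (tens (m : MB) x)) //.
by rewrite -linearZ_LR scale_tens.
Qed.
Definition fG : {linear tensor M X -> YG} := tliftL actM_bal actM_scale.
Lemma fG_tens m x : fG (tens m x) = f (tens (m : MB) x).
Proof. exact: tliftL_tens. Qed.

Lemma fG_im y : y \in im f <-> exists t, fG t = y.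
Proof.
split=> [/asboolP[t <-]|[t <-]].
  elim/tensor_ind: t => [|x x' [t e] [t' e']|m x].
  - by exists 0; rewrite !linear0.
  - by exists (t + t'); rewrite !linearD e e'.
  - by exists (tens (m : M) x); rewrite fG_tens.
elim/tensor_ind: t => [|x x' e e'|m x].
- by rewrite linear0 rpred0.
- by rewrite linearD rpredD.
- by rewrite fG_tens; apply/asboolP; exists (tens (m : MB) x).
Qed.

Fact piY_linear : linear (quotmod_pi (im f) : YG -> V).
Proof. by move=> a x y; exact: (@quotmod_pi_linear _ Y (im f) (te_inj a)). Qed.
Definition piY : {linear YG -> V} := lin_of piY_linear.

Lemma piY0 y : piY y = 0 <-> exists t, fG t = y.
Proof.
rewrite -fG_im -quotmod_pi_eq0; split=> [e|/eqP//].
by apply/eqP.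
Qed.

Definition repV (v : V) : Y := quotmod_repr (v : coker f).
Lemma repVK v : piY (repV v) = v.
Proof. exact: (@quotmod_reprK _ _ (im f)). Qed.
Lemma piY_surj v : exists y, piY y = v.
Proof. by exists (repV v); apply: repVK. Qed.

Lemma piY_factor (W : zmodType) (h : Y -> W) (hB : {morph h : x y / x - y}) :
  (forall t, h (f t) = 0) -> forall y v, piY y = v -> h (repV v) = h y.
Proof.
move=> hf y v yv; apply/eqP; rewrite -subr_eq0 -hB.
have /asboolP[t <-] : repV v - y \in im f.
  by rewrite -quotmod_eq; apply/eqP; rewrite [RHS]yv; apply: repVK.
by rewrite hf.
Qed.

(** [g] kills the image of [N (x) im f], so it factors through [N (x) V]. *)
Definition actN (n : N) (v : V) : X := g (tens (n : NB) (repV v)).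
Lemma actN_pi n y : actN n (piY y) = g (tens (n : NB) y).
Proof.
apply: (piY_factor (h := fun y => g (tens (n : NB) y))) => // [x x'|t].
  by rewrite -linearB; congr (g _); apply/eqP; rewrite eq_sym subr_eq -tensDr subrK.
exact: g_f0.
Qed.
Fact actN_bal : balanced actN.
Proof.
split=> [n n' v|n v v'|n a v].
- by rewrite /actN -linearD -[in RHS](@tensDl _ NB).
- by rewrite -[v]repVK -[v']repVK -linearD !actN_pi (@tensDr _ NB) linearD.
- by rewrite -[v]repVK -linearZ_LR !actN_pi -(@tens_bal _ NB).
Qed.
Fact actN_scale r n v : actN (r *: n) v = r *: actN n v.
Proof. by rewrite /actN -linearZ_LR scale_tens. Qed.
Definition gG : {linear tensor N V -> X} := tliftL actN_bal actN_scale.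
Lemma gG_tens n y : gG (tens n (piY y)) = g (tens (n : NB) y).
Proof. by rewrite [LHS]tliftL_tens actN_pi. Qed.

Lemma gG_im x : x \in im g <-> exists t, gG t = x.
Proof.
split=> [/asboolP[t <-]|[t <-]].
  elim/tensor_ind: t => [|x1 x2 [t e] [t' e']|n y].
  - by exists 0; rewrite !linear0.
  - by exists (t + t'); rewrite !linearD e e'.
  - by exists (tens (n : N) (piY y)); rewrite gG_tens.
elim/tensor_ind: t => [|x1 x2 e e'|n v].
- by rewrite linear0 rpred0.
- by rewrite linearD rpredD.
- by rewrite -[v]repVK gG_tens; apply/asboolP; exists (tens (n : NB) (repV v)).
Qed.

Definition piX : {linear X -> U} := lin_of (@quotmod_pi_linear _ _ (im g)).
Lemma piX0 x : piX x = 0 <-> exists t, gG t = x.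
Proof. by rewrite -gG_im -quotmod_pi_eq0; split=> [e|/eqP//]; apply/eqP. Qed.
Lemma piX_surj u : exists x, piX x = u.
Proof. exact: quotmod_pi_surj. Qed.

(** [gG] is onto the image of [g], to which its source is isomorphic. *)
Lemma gG_inj : left_noetherian A -> fin_gen (tensor N V) ->
  lmod_iso (tensor NB (coker f)) (submod (im g)) -> injective gG.
Proof.
move=> nA fgNV iso.
have imP t : gG t \in im g by apply/gG_im; exists t.
have hl : linear (fun t => Sub (gG t) (imP t) : submod (im g)).
  by move=> a x y; apply: val_inj; apply: (linearP gG).
have rB : balanced (fun (n : NB) (v : coker f) => tens (n : N) (v : V)).
  split=> [n n' v|n v v'|n b v].
  - exact: (@tensDl _ N V).
  - exact: (@tensDr _ N V).
  - by rewrite scale_coker; apply: (@tens_bal _ N V n (te_proj b) v).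
have rZ a (n : NB) (v : coker f) : tens (a *: n : N) (v : V) = a *: tens (n : N) (v : V).
  by rewrite scale_tens.
suff h_inj : injective (lin_of hl).
  by move=> x y e; apply: h_inj; apply: val_inj.
apply: (hopfian_inj (r := tliftL rB rZ)) iso _ _ => //.
- case=> x xP; have /gG_im[t tx] := xP; exists t; exact: val_inj.
- elim/tensor_ind => [|_ _ [t <-] [t' <-]|n v].
  + by exists 0; rewrite linear0.
  + by exists (t + t'); rewrite linearD.
  + by exists (tens (n : NB) (v : coker f)); rewrite tliftL_tens.
Qed.

Definition actJ (j : J) (v : V) : YG := te_ideal j *: repV v.
Lemma actJ_pi j y : actJ j (piY y) = te_ideal j *: (y : Y).
Proof.
apply: (piY_factor (h := fun y => te_ideal j *: y)) => // [x x'|t].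
  exact: scalerBr.
exact: ideal_f0.
Qed.
Fact actJ_bal : balanced actJ.
Proof.
split=> [j j' v|j v v'|j a v].
- by rewrite /actJ te_idealD scalerDl.
- by rewrite -[v]repVK -[v']repVK -linearD !actJ_pi scalerDr.
- rewrite -[v]repVK -linearZ_LR !actJ_pi [RHS](_ : _ = te_ideal j *: (te_inj a *: repV v)) //.
  by rewrite scalerA te_ideal_mul.
Qed.
Fact actJ_scale r j v : actJ (r *: j) v = r *: actJ j v.
Proof.
by rewrite /actJ [RHS](_ : _ = te_inj r *: (te_ideal j *: repV v)) // scalerA te_mul_ideal.
Qed.
Definition jG : {linear tensor J V -> YG} := tliftL actJ_bal actJ_scale.
Lemma jG_tens j y : jG (tens j (piY y)) = te_ideal j *: (y : Y).
Proof. by rewrite [LHS]tliftL_tens actJ_pi. Qed.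

Lemma jG_im y : y \in ideal_mul Y <-> exists t, jG t = y.
Proof.
split=> [/asboolP[s ->]|[t <-]].
  exists (\sum_(p <- s) tens p.1 (piY p.2)); rewrite linear_sum.
  by apply: eq_bigr => p _; rewrite jG_tens.
elim/tensor_ind: t => [|x1 x2 e e'|j v].
- by rewrite linear0 rpred0.
- by rewrite linearD rpredD.
- by rewrite -[v]repVK jG_tens; apply/asboolP; exists [:: (j, repV v)]; rewrite big_seq1.
Qed.

(** [jG] is onto [JY], to which its source is isomorphic over [B]; finite
    generation and the Hopfian argument take place over [G]. *)
Lemma jG_inj : left_noetherian G -> fin_gen (tensor J V) ->
  lmod_iso (tensor JB (coker f)) (submod (ideal_mul Y)) -> injective jG.
Proof.
move=> nG fgJV /(lmod_iso_resl (@te_inj G J)) iso.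
have imP t : jG t \in ideal_mul Y by apply/jG_im; exists t.
have hl : linear (fun t => Sub (jG t) (imP t) : resl (@te_inj G J) (submod (ideal_mul Y))).
  by move=> a x y; apply: val_inj; apply: (linearP jG).
have rB : balanced (fun (j : JB) (v : coker f) => tens (j : J) (v : V)).
  split=> [n n' v|n v v'|n b v].
  - exact: (@tensDl _ J V).
  - exact: (@tensDr _ J V).
  - by rewrite scale_coker; apply: (@tens_bal _ J V n (te_proj b) v).
have rl := tlift_resl_linear (phi := te_inj) rB
  (fun r u v => esym (@scale_tens _ _ J V r u v)).
suff h_inj : injective (lin_of hl).
  by move=> x y e; apply: h_inj; apply: val_inj.
apply: (hopfian_inj (r := lin_of rl)) iso _ _ => //.
- case=> x xP; have /jG_im[t tx] := xP; exists t; exact: val_inj.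
- elim/tensor_ind => [|_ _ [t <-] [t' <-]|n v].
  + by exists 0; rewrite linear0.
  + by exists (t + t'); rewrite linearD.
  + by exists (tens (n : JB) (v : coker f)); rewrite [LHS](tlift_tens rB).
Qed.

Local Notation W := (quotmod (sub_inside (im f) (ideal_mul Y))).
Local Notation WG := (resl (@te_inj G J) W).
Definition repU (u : U) : X := quotmod_repr u.
Lemma repUK u : piX (repU u) = u.
Proof. exact: quotmod_reprK. Qed.
Fact fG_in_im t : fG t \in im f. Proof. by apply/fG_im; exists t. Qed.
(** [fG] modulo [JY]; it kills [M (x) im g], as [f (m (x) g (n (x) y))] is the
    action of [m (x) n] on [y], so it factors through [fU] on [M (x) U]. *)
Definition fW (t : tensor M X) : WG :=
  quotmod_pi (sub_inside (im f) (ideal_mul Y)) (Sub (fG t) (fG_in_im t)).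
Fact fW_linear : linear fW.
Proof.
move=> a x y; rewrite /fW [RHS](_ : _ = te_inj a *: (fW x : W) + (fW y : W)) //.
rewrite -[RHS](@quotmod_pi_linear _ _ (sub_inside (im f) (ideal_mul Y))).
by congr quotmod_pi; apply: val_inj; apply: (linearP fG).
Qed.
Lemma fW_eq0 t : (fW t == 0) = (fG t \in ideal_mul Y).
Proof. exact: quotmod_pi_eq0. Qed.
Lemma fW_ideal m t : fW (tens m (gG t)) = 0.
Proof.
apply/eqP; rewrite fW_eq0 fG_tens.
elim/tensor_ind: t => [|x y ex ey|n v]; first by rewrite linear0 tens0r linear0 rpred0.
  by rewrite linearD tensDr linearD rpredD.
rewrite -[v]repVK gG_tens; case: fgP => _ ->.
by apply/asboolP; exists [:: (tens m n, repV v)]; rewrite big_seq1.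
Qed.
Lemma fW0 t : fG t = 0 -> fW t = 0.
Proof. by move=> t0; apply/eqP; rewrite fW_eq0 t0 rpred0. Qed.
Lemma fW_surj w : exists t, fW t = w.
Proof.
have [[y yP] <-] := quotmod_pi_surj w; have /fG_im[t ty] := yP.
by exists t; congr quotmod_pi; apply: val_inj.
Qed.
Let fWL := lin_of fW_linear.

Lemma fW_pi m x u : piX x = u -> fW (tens m (repU u)) = fW (tens m x).
Proof.
move=> xu; have /piX0[t tE] : piX (repU u - x) = 0 by rewrite linearB repUK xu subrr.
have -> : repU u = gG t + x by rewrite tE subrK.
by rewrite tensDr [LHS](linearD fWL) [fWL _]fW_ideal add0r.
Qed.

Fact fU_bal : balanced (fun (m : M) (u : U) => fW (tens m (repU u))).
Proof.
split=> [m m' u|m u u'|m a u].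
- by rewrite tensDl [LHS](linearD fWL).
- rewrite (@fW_pi m (repU u + repU u')); last by rewrite linearD !repUK.
  by rewrite tensDr [LHS](linearD fWL).
- rewrite (@fW_pi m (a *: repU u)); last by rewrite linearZ_LR repUK.
  by rewrite tens_bal.
Qed.
Fact fU_scale r (m : M) (u : U) : fW (tens (r *: m : M) (repU u)) = r *: fW (tens m (repU u)).
Proof. by rewrite -scale_tens [LHS](linearZ_LR fWL). Qed.
Definition fU : {linear tensor M U -> WG} := tliftL fU_bal fU_scale.
Lemma fU_pi t : fU (tmapL M piX t) = fW t.
Proof.
elim/tensor_ind: t => [|x y ex ey|m x]; first by rewrite !linear0 [RHS](linear0 fWL).
  by rewrite !linearD ex ey [RHS](linearD fWL).
by rewrite tmapL_tens [LHS]tliftL_tens (@fW_pi m x).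
Qed.

Lemma fU_inj : left_noetherian G -> fin_gen (tensor M U) ->
  lmod_iso (tensor MB U) W -> injective fU.
Proof.
move=> nG fgMU /(lmod_iso_resl (@te_inj G J)) iso.
have rB : balanced (fun (m : MB) (u : U) => tens (m : M) u).
  split=> [n n' v|n v v'|n b v].
  - exact: (@tensDl _ M U).
  - exact: (@tensDr _ M U).
  - exact: (@tens_bal _ M U).
have rl := tlift_resl_linear (phi := te_inj) rB
  (fun r u v => esym (@scale_tens _ _ M U r u v)).
apply: (hopfian_inj (r := lin_of rl)) iso _ _ => //.
- by move=> w; have [t <-] := fW_surj w; exists (tmapL M piX t); apply: fU_pi.
- elim/tensor_ind => [|_ _ [t <-] [t' <-]|n v].
  + by exists 0; rewrite linear0.
  + by exists (t + t'); rewrite linearD.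
  + by exists (tens (n : MB) v); rewrite [LHS](tlift_tens rB).
Qed.

(** If [fG t = 0], then [t] dies in [M (x) U], so it comes from
    [M (x) (N (x) V)], where [fG] is the map [jG] up to associativity. *)
Lemma fG_inj : injective fU -> injective jG -> injective fG.
Proof.
move=> fUi jGi; apply: linear_inj0 => t t0.
have pt : tmapL M piX t = 0 by apply: fUi; rewrite fU_pi linear0 fW0.
have [x /piX0//|k kt] := tensor_right_exact (i := gG) (p := piX) piX_surj _ pt.
have [as1 [as2 [_ as2K _ as2E]]] := tensor_assoc M N V.
have E z : fG (tmapL M gG z) = jG (as2 z).
  elim/tensor_ind: z => [|x y ex ey|m x]; first by rewrite !linear0.
    by rewrite !linearD ex ey.
  elim/tensor_ind: x => [|x y ex ey|n v]; first by rewrite tens0r !linear0.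
    by rewrite tensDr !linearD ex ey.
  by rewrite tmapL_tens as2E -[v]repVK gG_tens fG_tens jG_tens; case: fgP.
suff k0 : k = 0 by rewrite -kt k0 linear0.
apply: (can_inj as2K); rewrite linear0; apply: jGi.
by rewrite -E kt t0 linear0.
Qed.
End Quadruples.

(** * The Gorenstein-projective quadruple *)

(** The embeddings [cX] and [cY] of the rows produced by the horseshoe lemma are
    assumed compatible with the two injections [gG] and [fG]; this is exactly
    what makes the pair [C]-linear. *)
Section Resolution.
Variables (A G : pzRingType) (M : bimodType G A) (N : bimodType A G).
Local Notation J := (tensor M N).
Local Notation B := (trivext G J).
Local Notation MB := (left_over_B M N).
Local Notation NB := (right_over_B M N).
Variables (X : lmodType A) (Y : lmodType B).
Variables (f : {linear tensor MB X -> Y}) (g : {linear tensor NB Y -> X}).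
Hypothesis fgP : is_quadruple f g.
Local Notation YG := (resl (@te_inj G J) Y).
Local Notation V := (resl (@te_inj G J) (coker f)).
Local Notation U := (coker g).
Variables (P : complex A) (Q : complex G).
Variables (s : forall i, {linear P i -> tensor_cx N Q (1 + i)}) (sP : twisting s).
Local Notation XC := (twisted sP).
Variables (t : forall i, {linear Q i -> tensor_cx M XC (1 + i)}) (tP : twisting t).
Local Notation YC := (twisted tP).
Variables (b : {linear V -> Q 0}) (cX : {linear X -> XC 0}) (cY : {linear YG -> YC 0}).
Hypotheses (cXK : kernel_map cX) (cYK : kernel_map cY).
Hypothesis cX_gG : forall k, cX (gG fgP k) = (0, tmapL N b k).
Hypothesis cY_fG : forall k, cY (fG f k) = (0, tmapL M cX k).
Hypothesis cY1 : forall y, (cY y).1 = b (piY f y).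

Lemma cX_g (n : N) (y : YG) : cX (g (tens (n : NB) y)) = (0, tens n (cY y).1).
Proof. by rewrite -(gG_tens fgP) cX_gG tmapL_tens cY1. Qed.

Lemma cY_f (m : M) x : cY (f (tens (m : MB) x)) = (0, tens m (cX x)).
Proof. by rewrite -fG_tens cY_fG tmapL_tens. Qed.

Lemma cY_ideal (j : J) (y : YG) :
  cY (te_ideal j *: (y : Y)) = (0, ideal_act M N (P 0) (cY y).1 j).
Proof.
elim/tensor_ind: j => [|j j' e e'|m n].
- by rewrite te_ideal0 scale0r !linear0.
- by rewrite te_idealD scalerDl !linearD e e' -pair0D.
- by have [_ <-] := fgP; rewrite cY_f cX_g ideal_act_tens.
Qed.

Definition resolve (z : quad_mod fgP) : induced_cx tP 0 := (cX z.1, cY z.2).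
Fact resolve_linear : linear resolve.
Proof.
have rD x y : resolve (x + y) = resolve x + resolve y.
  by congr (_, _); apply: linearD.
move=> c z w; rewrite rD; congr (_ + _).
case: c z {w} => [[a n] [m [h j]]] [x y].
have -> : (((a, n), (m, (h, j))) : nctensor M N) *: ((x, y) : quad_mod fgP)
  = (a *: x + g (tens (n : NB) y), f (tens (m : MB) x) + ((h, j) : B) *: y) by [].
have -> : ((h, j) : B) *: y = te_inj h *: y + te_ideal j *: y.
  by rewrite -scalerDl; congr (_ *: _); apply: te_split.
have E z1 z2 : resolve (z1, z2) = (cX z1, cY z2) by [].
rewrite !E; move: (cY_ideal j y) (cX_g n y).
have -> : cY (f (tens (m : MB) x) + (te_inj h *: y + te_ideal j *: y))
  = cY (f (tens (m : MB) x)) + (h *: cY y + cY (te_ideal j *: y)).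
  by rewrite -linearZ_LR -!linearD.
rewrite linearD linearZ_LR cY_f.
case: (cY y) => q u /= -> ->.
apply/esym; apply: etrans (induced_scaleE a n m (h, j) (cX x) q u) _.
by congr (_, (_, _)); rewrite /= ?add0r ?addr0 // addrA.
Qed.

Lemma resolve_kernel : kernel_map (lin_of resolve_linear : {linear _ -> induced_cx tP 0}).
Proof.
case: cXK cYK => cXi cXE [cYi cYE]; split.
  move=> [x y] [x' y'] e; congr (_, _).
    by apply: cXi; apply: (congr1 fst e).
  by apply: cYi; apply: (congr1 snd e).
move=> z; split=> [dz|[[x y] <-]].
  have [x xE] := (cXE z.1).1 (congr1 fst dz); have [y yE] := (cYE z.2).1 (congr1 snd dz).
  by exists (x, y); case: z xE yE {dz} => z1 z2 /= <- <-.
by congr (_, _); [apply/cXE; exists x | apply/cYE; exists y].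
Qed.
End Resolution.

Theorem corollary4p2 (A G : pzRingType)
    (noethA : noetherian A) (noethG : noetherian G)
    (M : bimodType G A) (N : bimodType A G)
    (fgMl : fin_gen M) (fgMr : fin_gen (rmod_op A M))
    (fgNl : fin_gen N) (fgNr : fin_gen (rmod_op G N))
    (wcM : weakly_compatible M) (wcN : weakly_compatible N)
    (wcMN : weakly_compatible (tensor M N))
    (X : lmodType A) (Y : lmodType (trivext G (tensor M N)))
    (f : {linear tensor (left_over_B M N) X -> Y})
    (g : {linear tensor (right_over_B M N) Y -> X})
    (fgP : is_quadruple f g)
    (fgXY : fin_gen (quad_mod fgP))
    (GPf : gorenstein_projective (resl te_inj (coker f)))
    (GPg : gorenstein_projective (coker g))
    (isoN : lmod_iso (tensor (right_over_B M N) (coker f)) (submod (im g)))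
    (isoM : lmod_iso (tensor (left_over_B M N) (coker g))
                     (quotmod (sub_inside (im f) (ideal_mul Y))))
    (isoJ : lmod_iso (tensor (ideal_over_B M N) (coker f))
                     (submod (ideal_mul Y))) :
  gorenstein_projective (quad_mod fgP).
Proof.
have [Q [fpQ teQ /iso_kernel_map[bV bVK]]] := GPf.
have [P [fpP teP /iso_kernel_map[bU bUK]]] := GPg.
have [exQ QG] := teQ; have [exP PA] := teP.
have fgV : fin_gen (resl te_inj (coker f)).
  exact: kernel_map_fin_gen exQ (fpQ _).1 bVK.
have fgU : fin_gen (coker g) by apply: kernel_map_fin_gen exP (fpP _).1 bUK.
have gi : injective (gG fgP).
  exact: gG_inj noethA.1 (fin_gen_tensor fgNl fgV) isoN.
have fgJ : fin_gen (tensor M N) by apply: fin_gen_tensor fgMl fgNl.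
have fi : injective (fG f).
  apply: (@fG_inj _ _ _ _ _ _ _ _ fgP).
    exact: fU_inj noethG.1 (fin_gen_tensor fgMl fgU) isoM.
  exact: jG_inj noethG.1 (fin_gen_tensor fgJ fgV) isoJ.
have exNQ : exact_cx (tensor_cx N Q) := wcN.2 Q fpQ teQ.
have exMP : exact_cx (tensor_cx M P) := wcM.2 P fpP teP.
have exMNQ : exact_cx (tensor_cx M (tensor_cx N Q)).
  by apply: tensor_cx_assoc; apply: wcMN.2.
have PN : hom_exact P N := wcN.1 P fpP teP.
have QM : hom_exact Q M := wcM.1 Q fpQ teQ.
have QJ : hom_exact Q (tensor M N) := wcMN.1 Q fpQ teQ.
have PE i : hom_exact P (tensor_cx N Q i).
  exact: hom_exact_tensor (fpQ i).1 (fpQ i).2 PN.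
have [s [sP [cX [cXK _ cXg]]]] := horseshoe (fun i => (fpP i).2) exP exNQ PE
  (And3 gi (piX0 fgP) (@piX_surj _ _ _ _ _ _ g)) (tensor_kernel_map exQ exNQ bVK) bUK.
have exX : exact_cx (twisted sP) by apply: twisted_exact.
have exMX : exact_cx (tensor_cx M (twisted sP)) by apply: tensor_twisted_exact.
have QE i : hom_exact Q (tensor_cx M (twisted sP) i).
  apply: (@hom_exact_split _ _ (tensor M (P i)) (tensor M (tensor N (Q i))) _
    (tmapL M (inlL _ _)) (tmapL M (fstL _ _)) (tmapL M (inrL _ _)) (tmapL M (sndL _ _))).
  - elim/tensor_ind => [|x y ex ey|m z]; first by rewrite !linear0 addr0.
      by rewrite {1}ex {1}ey !linearD addrACA.
    by rewrite !tmapL_tens -tensDr -inlrL.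
  - exact: hom_exact_tensor (fpP i).1 (fpP i).2 QM.
  - exact: hom_exact_tensor2 (fpQ i).1 (fpQ i).2 QJ.
have [t [tP [cY [cYK cY1 cYf]]]] := horseshoe (fun i => (fpQ i).2) exQ exMX QE
  (And3 fi (@piY0 _ _ _ _ _ _ f) (@piY_surj _ _ _ _ _ _ f)) (tensor_kernel_map exX exMX cXK) bVK.
have exY : exact_cx (twisted tP) by apply: twisted_exact.
exists (induced_cx tP); split.
- move=> i; have [fgPi prPi] := fpP i; have [fgQi prQi] := fpQ i.
  by split; [apply: induced_fin_gen | apply: induced_projective].
- exact: induced_totally_exact.
- apply/iso_kernel_map; exists (lin_of (resolve_linear cXg cYf cY1)).
  exact: resolve_kernel.
Qed.
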